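(* Let $\mu$ be a measure supported on some compact subset of the real line. Assume further that $\mu$ is regular and has essential support equal to $[-2,2]$. Define $\varphi(w)=\frac12\left(w+\sqrt{w^2-4}\right)$, the conformal map from the complement of $[-2,2]$ to the exterior of the closed unit disk. Then there exists a subsequence $\mathcal{N}\subseteq\mathbb{N}$ of asymptotic density $1$ such that $$\lim_{\substack{n\to\infty\\ n\in\mathcal{N}}}\frac{\varphi(z)\,p_{n-1}(z;\mu)}{p_n(z;\mu)}=1$$ for all $z\in\mathbb{C}\setminus\mathrm{supp}(\mu)$.
   Context: All measures are positive, finite, compactly supported Borel measures with infinite support. $p_n(z;\mu)=\kappa_n z^n+\cdots$, $\kappa_n>0$, is the degree-$n$ orthonormal polynomial of $\mu$: $\int \overline{p_n}\,p_m\,d\mu=\delta_{nm}$. The measure $\mu$ is called regular if $\lim_{n\to\infty}\kappa_n^{-1/n}=\mathrm{capacity}(\mathrm{supp}(\mu))$ (logarithmic capacity). The essential support of $\mu$ is $\mathrm{supp}(\mu)$ with its isolated points removed. The branch of the square root is the one with $\varphi(w)\sim w$ at $\infty$. A set $\mathcal{N}\subseteq\mathbb{N}$ has asymptotic density $1$ if $\lim_{n\to\infty}\#(\mathcal{N}\cap\{1,\dots,n\})/n=1$. *)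

(* Defs.v *)
From HB Require Import structures.
From mathcomp Require Import all_boot all_order all_algebra.
From mathcomp Require Import complex.
From mathcomp Require Import all_classical all_reals all_analysis.

Set Implicit Arguments.
Unset Strict Implicit.
Unset Printing Implicit Defensive.

Import Order.TTheory GRing.Theory Num.Theory.
Import numFieldNormedType.Exports.

Local Open Scope classical_set_scope.
Local Open Scope ring_scope.
Local Open Scope complex_scope.

Section measures.
Context {R : realType}.
Implicit Types (mu : {finite_measure set (measurableTypeR R) -> \bar R}).

Definition supp mu : set R :=
  [set x | forall U : set R, open U -> U x -> (0 < mu U)%E].

Definition ess_supp mu : set R := supp mu `\` isolated (supp mu).

(* The integrand takes the value +oo on the diagonal, since lne 0 = -oo. *)
Definition log_energy (nu : probability (measurableTypeR R) R) : \bar R :=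
  (\int[nu]_x \int[nu]_y - lne `|x - y|%:E)%E.

(* Logarithmic capacity of a compact K, as a subset of the complex plane; K
   being contained in R, so are the supports of the competing probability
   measures.  It is 0 when every energy is +oo, as expeR -oo = 0. *)
Definition capacity (K : set R) : \bar R :=
  expeR (- ereal_inf [set log_energy nu | nu in
    [set nu : probability (measurableTypeR R) R | nu (~` K) = 0%E]])%E.

Definition cintegral mu (f : R -> R[i]) : R[i] :=
  (\int[mu]_x complex.Re (f x)) +i* (\int[mu]_x complex.Im (f x)).

Definition orthonormal_polys mu (p : nat -> {poly R[i]}) : Prop :=
  [/\ forall n, size (p n) = n.+1,
      forall n, 0 < lead_coef (p n) &
      forall n m, cintegral mu (fun x => ((p n).[x%:C])^*%C * (p m).[x%:C])
                  = (n == m)%:R].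

(* The family p is unique, so the quantifier only names it.  In R[i],
   0 < lead_coef (p n) includes that lead_coef (p n) is real. *)
Definition regular mu : Prop :=
  forall p, orthonormal_polys mu p ->
    (complex.Re (lead_coef (p n)) `^ (- n%:R^-1))%:E @[n --> \oo]
      --> capacity (supp mu).

End measures.

Definition density_one (R : realType) (N : set nat) : Prop :=
  (\sum_(1 <= k < n.+1) \1_N k) / n%:R @[n --> \oo] --> (1 : R).

(* sqrtC takes values in the closed upper half-plane and its cut is the
   positive half-line, on which it is positive; the cuts of the two factors
   cancel on ]2, +oo[, so the product is holomorphic off [-2, 2] and ~ w at
   infinity, whereas sqrtC (w ^+ 2 - 4) is not. *)
Definition phi (R : realType) (w : R[i]) : R[i] :=
  (w + sqrtC (w - 2) * sqrtC (w + 2)) / 2.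

(* Main.v *)
From HB Require Import structures.
Require Import Defs.
From mathcomp Require Import all_boot all_order all_algebra.
From mathcomp Require Import complex.
From mathcomp Require Import all_classical all_reals all_analysis.
From mathcomp Require Import measurable_realfun ring lra zify.

Import Order.TTheory GRing.Theory Num.Theory.
Import numFieldNormedType.Exports.

Local Open Scope classical_set_scope.
Local Open Scope ring_scope.
Local Open Scope complex_scope.

(** Let [a_n], [b_n] be the Jacobi coefficients of [mu] and [kappa_n] the leading
    coefficient of [p_n].  Since [ln a_0 + ... + ln a_(n-1) = ln kappa_0 - ln kappa_n],
    regularity and [capacity (supp mu) >= 1] bound the means of [ln a_k] below by
    [- o(1)].  Conversely, test polynomials that are small on the support bound
    [|p_n(y)|] and [|p_n(-y)|] below for large [y]; expanding the ratios of consecutive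
    monic polynomials at [y] and [-y] to second order in [1/y] then shows that the means
    of [b_k^2 + 2 a_k^2] are at most [2 + o(1)].  As [a^2 - 1 - 2 ln a >= (a - 1)^2], the
    means of [b_k^2 + 2 (a_k - 1)^2] tend to 0, so along a set of density one
    [a_(n-j) -> 1] and [b_(n-j) -> 0] for every fixed [j].  For [z] off the support the
    Christoffel-Darboux formula bounds every [|p_k(z)|], [k <= n], by a multiple of
    [|p_(n-1)(z)| + |p_n(z)|]; hence the recurrence near [n] is a small perturbation of
    the free one, [z u_k = u_(k+1) + u_(k-1)], and forces
    [p_(n-1)(z) / p_n(z)] to be close to [1 / phi z].

    The lower bound on the capacity comes from probability measures on [-2, 2] obtained
    by repeatedly pulling back the uniform law of [0, 1] under [x |-> x^2 - 2]: each
    pullback halves the logarithmic potential on [-2, 2]. *)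

(** * Cesàro-null sequences and sets of density one *)

Section density.
Context {R : realType}.
Implicit Types (f g u : nat -> R).

(** The tail supremum of [|u|] supplies monotonicity and the limit; adding [1 / (n + 1)] makes it
    strictly positive, so that its square root can serve as a threshold. *)
Lemma cvg0_dominated u : u n @[n --> \oo] --> (0 : R) ->
  exists s : nat -> R, [/\ forall m n, (m <= n)%N -> s n <= s m,
    forall n, 0 < s n, forall n, u n <= s n & s n @[n --> \oo] --> (0 : R)].
Proof.
move=> u0; pose v n := `|u n|.
have v0 : v n @[n --> \oo] --> (0 : R) by rewrite -(normr0 R); exact: cvg_norm.
have vb : has_ubound (range v).
  apply: bounded_fun_has_ubound; apply: cvg_seq_bounded; exact/cvgP/v0.
have vs n : v n <= sups v n.
  apply: ub_le_sup; last by exists n => /=.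
  by case: vb => M HM; exists M => _ [k _ <-]; apply: HM; exists k.
exists (fun n => sups v n + n.+1%:R^-1); split.
- move=> m n mn; apply: lerD; first exact: nonincreasing_sups.
  by rewrite lef_pV2 ?posrE ?ltr0n// ler_nat.
- move=> n; rewrite ltr_wpDl ?invr_gt0 ?ltr0n//; exact: le_trans (normr_ge0 _) (vs n).
- move=> n; apply: le_trans (ler_norm _) _; apply: le_trans (vs n) _.
  by rewrite lerDl invr_ge0.
- rewrite -[0 : R](addr0 (0 : R)); apply: cvgD; first exact: cvg_sups.
  exact: cvg_harmonic.
Qed.

Lemma cvg0P u : (u n @[n --> \oo] --> (0 : R)) <->
  (forall e : R, 0 < e -> exists n0, forall n, (n0 <= n)%N -> `|u n| <= e).
Proof.
split => [/cvgr0Pnorm_le h e e0|h].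
  by have [n0 _ H] := h e e0; exists n0 => n; apply: H.
apply/cvgr0Pnorm_le => e /h[n0 H]; exists n0 => // n; exact: H.
Qed.

Definition cesaro_null f := forall e : R, 0 < e -> exists n0, forall n, (n0 <= n)%N ->
  \sum_(k < n) f k <= e * n%:R.

Lemma cesaro_null_cvg f : (forall n, 0 <= f n) -> cesaro_null f ->
  (\sum_(k < n.+1) f k) / n.+1%:R @[n --> \oo] --> (0 : R).
Proof.
move=> f0 h; apply/cvg0P => e /h[n0 H]; exists n0 => n le_n.
rewrite ger0_norm ?divr_ge0 ?sumr_ge0//.
by rewrite ler_pdivrMr ?ltr0n//; apply: H; exact: leqW.
Qed.

(** A Koopman-von Neumann argument: [N] consists of the [n] with [g n <= sqrt (s n)], where [s] is a
    nonincreasing majorant of the averages of [g]. *)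
Lemma cesaro_null_density1 g : (forall n, 0 <= g n) -> cesaro_null g ->
  exists N : set nat, density_one R N /\ forall e : R, 0 < e ->
    exists n0, forall n, (n0 <= n)%N -> N n -> g n <= e.
Proof.
move=> g0 gnull.
have [s [s_dec s_gt0 le_s s0]] := cvg0_dominated _ (cesaro_null_cvg _ g0 gnull).
exists [set n | g n <= Num.sqrt (s n)]; split; last first.
  move=> e e0; have /cvg0P/(_ (e ^+ 2)) := s0.
  rewrite exprn_gt0// => /(_ isT)[n0 H]; exists n0 => n /H Hn /= /le_trans; apply.
  have /ler_normlP[_ sn] := Hn.
  by rewrite -(ger0_norm (ltW e0)) -sqrtr_sqr; apply: ler_wsqrtr.
set N := (X in density_one R X).
(* Markov's inequality: since [s] decreases, each [k <= n] outside [N] has [g k >= sqrt (s n)],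
   while the sum of [g] up to [n] is at most [(n + 1) * s n]. *)
have key n : \sum_(1 <= k < n.+1) (1 - \1_N k : R) <= n.+1%:R * Num.sqrt (s n).
  have sq0 : 0 < Num.sqrt (s n) by rewrite sqrtr_gt0.
  rewrite -(ler_pM2r sq0) -mulrA -expr2 sqr_sqrtr ?(ltW (s_gt0 _))//.
  have := le_s n; rewrite ler_pdivrMr ?ltr0n// [s n * _]mulrC; apply: le_trans.
  rewrite -(big_mkord xpredT g) big_ltn//= -[leLHS]add0r lerD//.
  rewrite mulr_suml ler_sum_nat// => k /andP[_ kn].
  rewrite indicE; case: (boolP (k \in N)) => /= [_|]; first by rewrite subrr mul0r.
  rewrite notin_setE => /negP; rewrite -ltNge subr0 mul1r => /ltW; apply: le_trans.
  by apply: ler_wsqrtr; apply: s_dec; rewrite -ltnS.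
rewrite /density_one.
have -> : (fun n => (\sum_(1 <= k < n.+1) \1_N k) / n%:R : R) =
   (fun n => n%:R / n%:R - (\sum_(1 <= k < n.+1) (1 - \1_N k)) / n%:R).
  apply/funext => n; rewrite -mulrBl; congr (_ / _).
  by rewrite sumrB sumr_const_nat subn1 /= opprB addrCA subrr addr0.
rewrite -[X in _ --> X]subr0; apply: cvgB.
  apply/cvgrPdist_le => e e0; exists 1%N => // n /= n1.
  by rewrite divff ?subrr ?normr0 ?ltW// pnatr_eq0 -lt0n.
apply/cvg0P => e e0; have /cvg0P/(_ ((e / 2) ^+ 2)) := s0.
rewrite exprn_gt0 ?divr_gt0// => /(_ isT)[n0 H]; exists (maxn n0 1) => n.
rewrite geq_max => /andP[/H Hn n1].
have n_gt0 : 0 < n%:R :> R by rewrite ltr0n.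
rewrite ger0_norm; last first.
  apply: divr_ge0 => //; apply: sumr_ge0.
  by move=> k _; rewrite indicE; case: (_ \in _); rewrite ?subrr ?subr0.
rewrite ler_pdivrMr//; apply: le_trans (key n) _.
have sq : Num.sqrt (s n) <= e / 2.
  have /ler_normlP[_ sn] := Hn.
  rewrite -(ger0_norm (ltW (divr_gt0 e0 _)))// -sqrtr_sqr; exact: ler_wsqrtr.
apply: le_trans (ler_wpM2l _ sq) _; first by [].
rewrite mulrCA ler_pM2l// ler_pdivrMr// -natrM ler_nat; lia.
Qed.

(* A bound on this average controls [f (n - j)] for all fixed [j] at once. *)
Fixpoint geom_avg f n := f n + (if n is m.+1 then geom_avg f m / 2 else 0).

Lemma geom_avg_ge0 f n : (forall n, 0 <= f n) -> 0 <= geom_avg f n.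
Proof.
move=> f0; elim: n => [|n IH] /=; first by rewrite addr0.
by rewrite addr_ge0// divr_ge0.
Qed.

Lemma le_geom_avg f n j : (forall n, 0 <= f n) -> (j <= n)%N ->
  f (n - j)%N <= 2 ^+ j * geom_avg f n.
Proof.
move=> f0; elim: j n => [|j IH] n jn.
  by case: n {jn} => [|n]; rewrite subn0 expr0 mul1r lerDl ?divr_ge0 ?geom_avg_ge0.
case: n jn => // n; rewrite ltnS subSS => /IH /le_trans; apply.
rewrite exprS [2 * _]mulrC -mulrA ler_pM2l ?exprn_gt0//=.
by have := f0 n.+1; lra.
Qed.

Lemma sum_geom_avg f n : (forall n, 0 <= f n) ->
  \sum_(k < n) geom_avg f k <= 2 * \sum_(k < n) f k.
Proof.
move=> f0; case: n => [|n]; first by rewrite !big_ord0 mulr0.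
(* The extra last term closes the induction, because [2 * geom_avg f n.+1] equals
   [2 * f n.+1 + geom_avg f n]. *)
suff : \sum_(k < n.+1) geom_avg f k + geom_avg f n <= 2 * \sum_(k < n.+1) f k.
  by apply: le_trans; rewrite lerDl geom_avg_ge0.
elim: n => [|n IH]; first by rewrite !big_ord1 /=; lra.
by rewrite big_ord_recr [in leRHS]big_ord_recr /=; move: IH; lra.
Qed.

Lemma cesaro_null_density f : (forall n, 0 <= f n) -> cesaro_null f ->
  exists N : set nat, density_one R N /\ forall j (e : R), 0 < e ->
    exists n0, forall n, (n0 <= n)%N -> N n -> f (n - j)%N <= e.
Proof.
move=> f0 fnull.
have [|N [N1 HN]] := cesaro_null_density1 (geom_avg f) (fun n => geom_avg_ge0 f n f0).
  move=> e e0; have [n0 H] := fnull (e / 2) (divr_gt0 e0 (ltr0Sn R 1)).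
  exists n0 => n /H; have := sum_geom_avg f n f0; lra.
exists N; split => // j e e0.
have [n0 H] := HN (e / 2 ^+ j) (divr_gt0 e0 (exprn_gt0 _ (ltr0Sn R 1))).
exists (maxn n0 j) => n; rewrite geq_max => /andP[n0n jn] Nn.
apply: le_trans (le_geom_avg _ _ _ f0 jn) _.
by rewrite -ler_pdivlMl ?exprn_gt0// mulrC; exact: H.
Qed.

End density.

(** * Ratios of consecutive monic polynomials at large real points *)

Section pivots.
Context {R : realType}.
Implicit Types (a b : nat -> R) (M y : R).

(* The ratios [P_{k+1}(y) / P_k(y)] of the monic orthogonal polynomials with
   Jacobi coefficients [a], [b]. *)
Fixpoint pivot a b y k :=
  y - b k - (if k is m.+1 then a m ^+ 2 / pivot a b y m else 0).

(** The lower bound reproduces itself: as [M <= y / 4], one has [y - b k >= 3 y / 4], and the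
    subtracted quotient is at most [M^2 / (5 y / 8) <= y / 8]. *)
Lemma pivot_bounds a b M y k : 0 < M -> 4 * M <= y ->
  (forall k, 0 < a k <= M) -> (forall k, `|b k| <= M) ->
  5 / 8 * y <= pivot a b y k <= y + M.
Proof.
move=> M0 My aM bM; elim: k => [|k /andP[IH _]] /=.
  by have := bM 0%N; rewrite ler_norml => /andP[]; lra.
have := bM k.+1; rewrite ler_norml => /andP[b1 b2].
have /andP[a0 a1] := aM k.
have p0 : 0 < pivot a b y k by lra.
have q0 : 0 <= a k ^+ 2 / pivot a b y k by rewrite divr_ge0 ?sqr_ge0 ?ltW.
have q1 : a k ^+ 2 / pivot a b y k <= y / 8.
  rewrite ler_pdivrMr//; apply: (@le_trans _ _ (M ^+ 2)).
    by rewrite ler_sqr ?nnegrE; lra.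
  by nra.
lra.
Qed.

(** Changing the sign of [b] makes the terms linear in [b] cancel in the product. The two cross
    terms cost [2 M^3 / y] each and the last term [M^3 / y], whence the constant 5. *)
Lemma pivotM_le a b M y k : 0 < M -> 4 * M <= y ->
  (forall k, 0 < a k <= M) -> (forall k, `|b k| <= M) ->
  pivot a b y k * pivot a (- b) y k <=
    y ^+ 2 - b k ^+ 2 - 2 * (if k is m.+1 then a m ^+ 2 else 0) + 5 * M ^+ 3 / y.
Proof.
move=> M0 My aM bM; have y0 : 0 < y by lra.
have nbM j : `|(- b) j| <= M by rewrite fctE normrN.
have E0 : 0 <= M ^+ 3 / y by rewrite divr_ge0 ?exprn_ge0 ?ltW.
case: k => [|k]; first by rewrite /= fctE; lra.
have /andP[u1 u2] := pivot_bounds a b M y k M0 My aM bM.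
have /andP[v1 v2] := pivot_bounds a (- b) M y k M0 My aM nbM.
rewrite /=; set u := pivot a b y k in u1 u2 *; set v := pivot a (- b) y k in v1 v2 *.
rewrite fctE; have := bM k.+1; rewrite ler_norml => /andP[].
have /andP[a0 a1] := aM k; move: (b k.+1) (a k) a0 a1 => {aM bM nbM} b' a' a0 a1 b1 b2.
have u0 : 0 < u by lra.
have v0 : 0 < v by lra.
(* Since [v <= y + M], the quotient [(y - b') / v] is at least [1 - 2 M / y]. *)
have q1 : a' ^+ 2 - 2 * (M ^+ 3 / y) <= a' ^+ 2 * (y - b') / v.
  rewrite ler_pdivlMr//.
  have h : (1 - 2 * (M / y)) * v <= y - b'.
    have t : M / y * y = M by rewrite divfK// gt_eqF.
    have t0 : 0 < M / y by rewrite divr_gt0.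
    have t1 : M / y <= 1/4 by rewrite ler_pdivrMr//; lra.
    nra.
  have a2 : a' ^+ 2 <= M ^+ 2 by rewrite ler_sqr ?nnegrE; lra.
  have -> : M ^+ 3 / y = M ^+ 2 * (M / y) by rewrite exprSr mulrA.
  have t0 : 0 < M / y * v by rewrite mulr_gt0 ?divr_gt0.
  have a3 : 0 < a' ^+ 2 by rewrite exprn_gt0.
  nra.
have q2 : a' ^+ 2 - 2 * (M ^+ 3 / y) <= a' ^+ 2 * (y + b') / u.
  rewrite ler_pdivlMr//.
  have h : (1 - 2 * (M / y)) * u <= y + b'.
    have t : M / y * y = M by rewrite divfK// gt_eqF.
    have t0 : 0 < M / y by rewrite divr_gt0.
    have t1 : M / y <= 1/4 by rewrite ler_pdivrMr//; lra.
    nra.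
  have a2 : a' ^+ 2 <= M ^+ 2 by rewrite ler_sqr ?nnegrE; lra.
  have -> : M ^+ 3 / y = M ^+ 2 * (M / y) by rewrite exprSr mulrA.
  have t0 : 0 < M / y * u by rewrite mulr_gt0 ?divr_gt0.
  have a3 : 0 < a' ^+ 2 by rewrite exprn_gt0.
  nra.
have q3 : a' ^+ 4 / (u * v) <= M ^+ 3 / y.
  rewrite ler_pdivrMr ?mulr_gt0// mulrAC ler_pdivlMr//.
  have a4 : a' ^+ 4 <= M ^+ 4 by rewrite lerXn2r ?nnegrE; lra.
  apply: (@le_trans _ _ (M ^+ 4 * y)); first by rewrite ler_pM2r.
  rewrite exprSr -mulrA ler_pM2l ?exprn_gt0//; nra.
have -> : (y - b' - a' ^+ 2 / u) * (y - - b' - a' ^+ 2 / v) =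
  y ^+ 2 - b' ^+ 2 - a' ^+ 2 * (y - b') / v - a' ^+ 2 * (y + b') / u + a' ^+ 4 / (u * v).
  by field; rewrite !gt_eqF.
lra.
Qed.

Lemma ln_le_sub1 (x : R) : 0 < x -> ln x <= x - 1.
Proof. by move=> x0; have := @le_ln1Dx R (x - 1); rewrite [1 + _]addrC subrK; apply; lra. Qed.

(** Applying [ln x <= x - 1] to the product of the pivots divided by [y^2] trades that product for
    its logarithm, whose sum telescopes along the orthogonal polynomials. *)
Lemma sum_ln_pivotM_le a b M y n : 0 < M -> 4 * M <= y ->
  (forall k, 0 < a k <= M) -> (forall k, `|b k| <= M) ->
  \sum_(k < n) (b k ^+ 2 + 2 * a k ^+ 2) <=
  y ^+ 2 * (n%:R * ln (y ^+ 2) - \sum_(k < n) ln (pivot a b y k * pivot a (- b) y k))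
  + n%:R * (5 * M ^+ 3 / y) + 2 * M ^+ 2.
Proof.
move=> M0 My aM bM; have y0 : 0 < y by lra.
have nbM j : `|(- b) j| <= M by rewrite fctE normrN.
pose al k := if k is m.+1 then a m ^+ 2 else 0.
have step k : b k ^+ 2 + 2 * al k <= y ^+ 2 * (ln (y ^+ 2) -
    ln (pivot a b y k * pivot a (- b) y k)) + 5 * M ^+ 3 / y.
  have := pivotM_le a b M y k M0 My aM bM.
  have /andP[u1 _] := pivot_bounds a b M y k M0 My aM bM.
  have /andP[v1 _] := pivot_bounds a (- b) M y k M0 My aM nbM.
  rewrite -/(al k); set u := pivot a b y k in u1 *; set v := pivot a (- b) y k in v1 *.
  have uv0 : 0 < u * v by apply: mulr_gt0; lra.
  have y20 : 0 < y ^+ 2 by rewrite exprn_gt0.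
  have := ln_le_sub1 (u * v / y ^+ 2) (divr_gt0 uv0 y20).
  rewrite ln_div ?posrE// -(ler_pM2l y20).
  rewrite [_ * (u * v / _ - 1)]mulrBr mulrCA divff ?gt_eqF// !mulr1; lra.
(* The pivot at [k] involves [a (k - 1)]; shifting the index leaves one boundary term, at most
   [2 * M ^+ 2]. *)
have -> : \sum_(k < n) (b k ^+ 2 + 2 * a k ^+ 2) =
    \sum_(k < n) (b k ^+ 2 + 2 * al k) + 2 * al n.
  elim: n => [|n IH]; first by rewrite !big_ord0 /= mulr0 addr0.
  by rewrite !big_ord_recr /= IH; lra.
apply: lerD; last first.
  case: n => [|n] /=; first by rewrite ler_pM2l// sqr_ge0.
  by rewrite ler_pM2l// ler_sqr ?nnegrE; have := aM n; lra.
apply: (@le_trans _ _ (\sum_(k < n) (y ^+ 2 * (ln (y ^+ 2) -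
    ln (pivot a b y k * pivot a (- b) y k)) + 5 * M ^+ 3 / y))).
  by apply: ler_sum => k _; exact: step.
rewrite big_split /= -mulr_sumr sumrB !sumr_const card_ord.
by rewrite -(mulr_natl (ln _)) -(mulr_natl (_ / y)).
Qed.

Lemma jacobi_cesaro_null a b M : 0 < M ->
  (forall k, 0 < a k <= M) -> (forall k, `|b k| <= M) ->
  (forall e : R, 0 < e -> exists n0, forall n, (n0 <= n)%N ->
    - e * n%:R <= \sum_(k < n) ln (a k)) ->
  (forall w e : R, 1 < w -> 4 * M <= w -> 0 < e -> exists n0, forall n, (n0 <= n)%N ->
    (2 * ln w - e) * n%:R <=
    \sum_(k < n) ln (pivot a b (w + w^-1) k * pivot a (- b) (w + w^-1) k)) ->
  cesaro_null (fun k => b k ^+ 2 + 2 * (a k - 1) ^+ 2).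
Proof.
move=> M0 aM bM Ha Hw e e0.
(* The last entry absorbs two errors, [6 / w] from expanding [y^2] in [K1] and
   [5 M^3 / y <= 5 M^3 / w] from the pivots. *)
pose w := Num.max (Num.max 2 (4 * M)) ((6 + 5 * M ^+ 3) * 8 / e).
have M3 : 0 < M ^+ 3 by rewrite exprn_gt0.
have w2 : 2 <= w by rewrite !le_max lexx.
have wM : 4 * M <= w by rewrite !le_max lexx orbT.
have we : (6 + 5 * M ^+ 3) / w <= e / 8.
  have : (6 + 5 * M ^+ 3) * 8 / e <= w by rewrite le_max lexx orbT.
  rewrite !ler_pdivrMr//; last by lra.
  move=> h; rewrite mulrAC ler_pdivlMr//; lra.
clearbody w; have w0 : 0 < w by lra.
have wi0 : 0 < w^-1 by rewrite invr_gt0.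
have wi1 : w^-1 <= 1 by rewrite invf_le1//; lra.
pose y := w + w^-1; have yw : w <= y by rewrite lerDl ltW.
have y0 : 0 < y by lra.
have y20 : 0 < y ^+ 2 by rewrite exprn_gt0.
have [n1 H1] := Ha (e / 32) (divr_gt0 e0 (ltr0Sn R _)).
(* The allowed loss in growth is divided by [y ^+ 2] because it is multiplied by that factor in
   [sum_ln_pivotM_le]. *)
have d0 : 0 < e / 8 / y ^+ 2 by rewrite !divr_gt0.
have [|n2 H2] := Hw w (e / 8 / y ^+ 2) _ wM d0; first by lra.
have [n3 H3] : exists n3, forall n, (n3 <= n)%N -> 2 * M ^+ 2 <= e / 8 * n%:R.
  exists (Num.truncn (2 * M ^+ 2 / (e / 8))).+1 => n hn.
  rewrite -ler_pdivrMl ?divr_gt0// [_^-1 * _]mulrC.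
  apply: ltW; apply: lt_le_trans (truncnS_gt _) _; by rewrite ler_nat.
exists (maxn n1 (maxn n2 n3)) => n; rewrite !geq_max => /and3P[/H1 {}H1 /H2 {}H2 /H3 {}H3].
have My : 4 * M <= y by lra.
have := sum_ln_pivotM_le a b M y n M0 My aM bM; rewrite -/y in H2.
set S := \sum_(k < n) ln (pivot _ _ _ _ * _) in H2 *.
set n' := n%:R in H1 H2 H3 *.
have n'0 : 0 <= n' by rewrite ler0n.
move=> K.
(* As [y = w + 1/w], the difference [ln (y^2) - 2 ln w] is [2 ln (1 + w^-2) <= 2 w^-2]; multiplied
   by [y^2] it yields the main term 2 and an error of at most [6 / w]. *)
have K1 : y ^+ 2 * (n' * ln (y ^+ 2) - S) <= n' * (2 + 6 / w + e / 8).
  apply: (@le_trans _ _ (y ^+ 2 * (n' * (ln (y ^+ 2) - 2 * ln w + e / 8 / y ^+ 2)))).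
    by rewrite ler_pM2l//; lra.
  rewrite mulrCA; apply: ler_wpM2l => //.
  rewrite mulrDr [X in _ + X]mulrC divfK ?gt_eqF// lerD2r.
  have -> : ln (y ^+ 2) - 2 * ln w = 2 * ln (1 + w^-1 ^+ 2).
    rewrite lnXn// -[ln y *+ 2]mulr_natl -mulrBr -ln_div ?posrE//; congr (_ * ln _).
    by rewrite /y; field; rewrite gt_eqF.
  have L : ln (1 + w^-1 ^+ 2) <= w^-1 ^+ 2 by apply: le_ln1Dx; have := sqr_ge0 w^-1; lra.
  apply: (@le_trans _ _ (y ^+ 2 * (2 * w^-1 ^+ 2))); first by rewrite ler_pM2l// ler_pM2l.
  have -> : y ^+ 2 * (2 * w^-1 ^+ 2) = 2 * (1 + w^-1 ^+ 2) ^+ 2.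
    by rewrite /y; field; rewrite gt_eqF.
  have t0 : 0 <= w^-1 ^+ 2 by rewrite sqr_ge0.
  have t1 : w^-1 ^+ 2 <= w^-1 by rewrite expr2 ler_piMl// ltW.
  by nra.
have K2 : n' * (5 * M ^+ 3 / y) <= n' * (5 * M ^+ 3 / w).
  by apply: ler_wpM2l => //; rewrite ler_pM2l ?mulr_gt0// lef_pV2 ?posrE.
have K3 : n' * (6 / w) + n' * (5 * M ^+ 3 / w) <= n' * (e / 8).
  by rewrite -mulrDr -mulrDl; exact: ler_wpM2l.
have -> : \sum_(k < n) (b k ^+ 2 + 2 * (a k - 1) ^+ 2) =
    \sum_(k < n) (b k ^+ 2 + 2 * a k ^+ 2 - 4 * (a k - 1) - 2).
  by apply: eq_bigr => k _; ring.
(* Here [a - 1 >= ln a] brings in the lower bound on the sum of the [ln (a k)]. *)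
apply: (@le_trans _ _ (\sum_(k < n) (b k ^+ 2 + 2 * a k ^+ 2 - 4 * ln (a k) - 2))).
  apply: ler_sum => k _; have := ln_le_sub1 (a k); have /andP[-> _] := aM k.
  by move=> /(_ isT); lra.
rewrite !sumrB -mulr_sumr sumr_const card_ord -(mulr_natr 2 n) -/n'.
have en0 : 0 <= e * n' by rewrite mulr_ge0// ltW.
lra.
Qed.

End pivots.

(** * Jacobi coefficients of a positive functional on real polynomials *)

Section orthonormal.
Context {R : realType} (L : {scalar {poly R}}) (q : nat -> {poly R}).
Context (size_q : forall n, size (q n) = n.+1).
Context (lead_q : forall n, 0 < lead_coef (q n)).
Context (orth_q : forall n m, L (q n * q m) = (n == m)%:R).

Lemma lead_qE n : lead_coef (q n) = (q n)`_n.
Proof. by rewrite lead_coefE size_q. Qed.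

Lemma size_span n (P : {poly R}) : (size P <= n)%N ->
  exists c : nat -> R, P = \sum_(k < n) c k *: q k.
Proof.
elim: n P => [|n IH] P.
  by rewrite leqn0 size_poly_eq0 => /eqP ->; exists (fun=> 0); rewrite big_ord0.
move=> sP; pose t := P`_n / lead_coef (q n).
have [|c cP] := IH (P - t *: q n).
  apply/leq_sizeP => j; rewrite leq_eqVlt => /predU1P[<-|nj].
    by rewrite coefB coefZ -lead_qE divfK ?subrr ?gt_eqF.
  rewrite coefB coefZ (nth_default _ (leq_trans sP nj)) nth_default ?size_q//.
  by rewrite mulr0 subrr.
exists (fun k => if k == n then t else c k).
rewrite big_ord_recr /= eqxx -[LHS](subrK (t *: q n)) cP; congr (_ + _).
by apply: eq_bigr => i _; rewrite ltn_eqF.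
Qed.

Lemma L_span n (c : nat -> R) k : (k < n)%N ->
  L ((\sum_(i < n) c i *: q i) * q k) = c k.
Proof.
move=> kn; rewrite mulr_suml linear_sum /= (bigD1 (Ordinal kn))//= big1 ?addr0.
  by rewrite -scalerAl linearZ /= orth_q eqxx mulr1.
move=> i ik; rewrite -scalerAl linearZ /= orth_q; case: eqP => [e|]; last by rewrite mulr0.
by case/eqP: ik; apply: val_inj.
Qed.

Lemma L_span_sqr n (c : nat -> R) :
  L ((\sum_(i < n) c i *: q i) ^+ 2) = \sum_(i < n) c i ^+ 2.
Proof.
rewrite expr2 mulr_sumr linear_sum /=; apply: eq_bigr => i _.
by rewrite -scalerAr linearZ /= L_span// expr2.
Qed.

Lemma orthonormal_expand n (P : {poly R}) : (size P <= n)%N ->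
  P = \sum_(k < n) L (P * q k) *: q k.
Proof.
move=> /size_span[c ->]; apply: eq_bigr => k _; by rewrite L_span.
Qed.

Lemma L_low n (P : {poly R}) : (size P <= n)%N -> L (P * q n) = 0.
Proof.
move=> /size_span[c ->]; rewrite mulr_suml linear_sum /= big1// => i _.
by rewrite -scalerAl linearZ /= orth_q ltn_eqF// mulr0.
Qed.

Definition jac_a n := L ('X * q n * q n.+1).
Definition jac_b n := L ('X * q n * q n).

Lemma size_Xq n : size ('X * q n) = n.+2.
Proof. by rewrite mulrC size_mulX ?size_q// -size_poly_eq0 size_q. Qed.

(** Compare the coefficients of degree [n + 1] in the expansion of ['X * q n]. *)
Lemma lead_q_ratio n : jac_a n = lead_coef (q n) / lead_coef (q n.+1).
Proof.
have [|c cE] := size_span n.+2 ('X * q n); first by rewrite size_Xq.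
rewrite /jac_a cE L_span//.
have : ('X * q n)`_n.+1 = c n.+1 * lead_coef (q n.+1).
  rewrite cE coef_sum big_ord_recr /= big1 ?add0r ?coefZ ?lead_qE//.
  by move=> i _; rewrite coefZ nth_default ?mulr0// size_q.
by rewrite coefXM /= -lead_qE => ->; rewrite mulfK// gt_eqF.
Qed.

Lemma jac_a_gt0 n : 0 < jac_a n.
Proof. by rewrite lead_q_ratio divr_gt0. Qed.

(** Multiplication by ['X] is symmetric for [L]: for [i < n] the factor moves onto [q i], and
    ['X * q i] has too low a degree to see [q n.+1]. Three terms remain. *)
Lemma jacobi_recS n : 'X * q n.+1 =
  jac_a n.+1 *: q n.+2 + jac_b n.+1 *: q n.+1 + jac_a n *: q n.
Proof.
rewrite {1}(orthonormal_expand n.+3 ('X * q n.+1)) ?size_Xq//.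
rewrite 3!big_ord_recr /= big1 ?add0r.
  by rewrite [LHS]addrC [X in _ + X = _]addrC addrA /jac_a ['X * q n * _]mulrAC.
move=> i _; rewrite mulrAC L_low ?scale0r// size_Xq; by case: i.
Qed.

Lemma jacobi_rec0 : 'X * q 0 = jac_a 0 *: q 1 + jac_b 0 *: q 0.
Proof.
rewrite {1}(orthonormal_expand 2 ('X * q 0)) ?size_Xq//.
by rewrite 2!big_ord_recr big_ord0 /= add0r addrC.
Qed.

Context (S : set R) (M : R).
Context (L_ge0 : forall P : {poly R}, (forall x, S x -> 0 <= P.[x]) -> 0 <= L P).
Context (SM : forall x, S x -> `|x| <= M).

Lemma L_sqr_ge0 (P A : {poly R}) : (forall x, S x -> 0 <= A.[x]) -> 0 <= L (A * P ^+ 2).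
Proof.
by move=> A0; apply: L_ge0 => x /A0 ?; rewrite hornerM horner_exp mulr_ge0 ?sqr_ge0.
Qed.

Lemma LMX_ge0 (P : {poly R}) : - (M * L (P ^+ 2)) <= L ('X * P ^+ 2) <= M * L (P ^+ 2).
Proof.
have Sx x : S x -> - M <= x <= M by move=> /SM; rewrite ler_norml.
have /(L_sqr_ge0 P) : forall x, S x -> 0 <= (M *: 1 + 'X).[x].
  by move=> x /Sx; rewrite !hornerE; lra.
have /(L_sqr_ge0 P) : forall x, S x -> 0 <= (M *: 1 - 'X).[x].
  by move=> x /Sx; rewrite !hornerE; lra.
rewrite !mulrDl mulNr -!scalerAl mul1r !linearD linearN linearZ /=; lra.
Qed.

Lemma jac_b_le n : `|jac_b n| <= M.
Proof.
have := LMX_ge0 (q n); rewrite expr2 orth_q eqxx mulr1 mulrA.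
by rewrite ler_norml.
Qed.

(** Polarization: the values of [L] on ['X * (q n + q n.+1) ^+ 2] and ['X * (q n - q n.+1) ^+ 2]
    differ by [4 * jac_a n] and lie in [[-2M, 2M]]. *)
Lemma jac_a_le n : jac_a n <= M.
Proof.
have := LMX_ge0 (q n + q n.+1); have := LMX_ge0 (q n - q n.+1).
set Q := q n; set Q' := q n.+1.
have -> : (Q - Q') ^+ 2 = Q * Q - Q * Q' - Q * Q' + Q' * Q' by ring.
have -> : (Q + Q') ^+ 2 = Q * Q + Q * Q' + Q * Q' + Q' * Q' by ring.
have -> : 'X * (Q * Q - Q * Q' - Q * Q' + Q' * Q') =
  'X * Q * Q - 'X * Q * Q' - 'X * Q * Q' + 'X * Q' * Q' by ring.
have -> : 'X * (Q * Q + Q * Q' + Q * Q' + Q' * Q') =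
  'X * Q * Q + 'X * Q * Q' + 'X * Q * Q' + 'X * Q' * Q' by ring.
rewrite !linearD !linearN /= !orth_q !eqxx ltn_eqF// -/(jac_a n) -/(jac_b n).
rewrite -/(jac_b n.+1) -/Q -/Q' /= !mulr1n !mulr0n.
by move=> /andP[h1 h2] /andP[h3 h4]; lra.
Qed.

End orthonormal.

(** * Pivots as ratios of a positive solution of the recurrence *)

Section pivot_solution.
Context {R : realType} (a b : nat -> R) (y : R) (r : nat -> R).
Context (a_gt0 : forall k, 0 < a k) (piv_gt0 : forall k, 0 < pivot a b y k).
Context (r0_gt0 : 0 < r 0%N) (rec0 : a 0%N * r 1%N = (y - b 0%N) * r 0%N).
Context (recS : forall k,
  y * r k.+1 = a k.+1 * r k.+2 + b k.+1 * r k.+1 + a k * r k).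

Lemma pivot_ratio k : 0 < r k /\ a k * r k.+1 = pivot a b y k * r k.
Proof.
elim: k => [|k [rk IH]]; first by rewrite /= subr0.
have rk1 : 0 < r k.+1.
  by rewrite -(pmulr_rgt0 _ (a_gt0 k)) IH mulr_gt0.
split=> //=; rewrite mulrBl mulrBl recS.
have -> : a k ^+ 2 / pivot a b y k * r k.+1 = a k * r k.
  apply: (mulIf (lt0r_neq0 (piv_gt0 k))); rewrite -[RHS]mulrA [r k * _]mulrC -IH.
  by rewrite mulrAC divfK ?gt_eqF// expr2 mulrA.
ring.
Qed.

Lemma sum_ln_pivot n :
  \sum_(k < n) ln (pivot a b y k) = \sum_(k < n) ln (a k) + ln (r n) - ln (r 0).
Proof.
elim: n => [|n IH]; first by rewrite !big_ord0 add0r subrr.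
have [rn E] := pivot_ratio n; have [rn1 _] := pivot_ratio n.+1.
rewrite !big_ord_recr /= IH.
have : ln (a n * r n.+1) = ln (pivot a b y n * r n) by rewrite E.
by rewrite !lnM ?posrE//; lra.
Qed.

(** Doubling lets the last term control the sum of squares in the Christoffel inequality, by
    [sum_sqr_doubling]. *)
Lemma pivot_growth M k : (forall k, a k <= M) ->
  (forall k, 2 * M <= pivot a b y k) -> 2 * r k <= r k.+1.
Proof.
move=> aM pM; have [rk E] := pivot_ratio k; have [rk1 _] := pivot_ratio k.+1.
have M0 : 0 < M by exact: lt_le_trans (a_gt0 k) (aM k).
rewrite -(ler_pM2l M0); apply: (@le_trans _ _ (a k * r k.+1)); last by rewrite ler_pM2r.
by rewrite E mulrA [M * 2]mulrC ler_pM2r.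
Qed.

End pivot_solution.

Lemma sum_sqr_doubling {R : realType} (r : nat -> R) n :
  (forall k, 0 < r k) -> (forall k, 2 * r k <= r k.+1) ->
  \sum_(k < n.+1) r k ^+ 2 <= 2 * r n ^+ 2.
Proof.
move=> r0 r2; elim: n => [|n IH].
  by rewrite big_ord1; have := sqr_ge0 (r 0%N); lra.
rewrite big_ord_recr /=; have := r2 n; have := r0 n; have := r0 n.+1; nra.
Qed.

(** * Chebyshev polynomials of degree [2^k] as test polynomials *)

Section doubling_poly.
Context {R : realType}.
Implicit Types (x w : R).

(* [T_{2^k}] for the Chebyshev polynomials normalised by
   [T_n(w + 1/w) = w^n + w^-n]. *)
Fixpoint dbl_poly k : {poly R} := if k is m.+1 then dbl_poly m ^+ 2 - 2%:P else 'X.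

Lemma size_dbl_poly k : (size (dbl_poly k) <= (2 ^ k).+1)%N.
Proof.
elim: k => [|k IH] /=; first by rewrite size_polyX.
apply: leq_trans (size_polyD _ _) _; rewrite size_polyN geq_max.
apply/andP; split; last by apply: leq_trans (size_polyC_leq1 _) _.
apply: leq_trans (size_poly_exp_leq _ _) _; rewrite ltnS expnSr leq_mul2r /=.
by rewrite -subn1 leq_subLR.
Qed.

Lemma dbl_poly_joukowski k x w : 0 < w -> `|x| = w + w^-1 ->
  `|(dbl_poly k).[x]| = w ^+ (2 ^ k) + w ^- (2 ^ k).
Proof.
move=> w0 xw; elim: k => [|k IH] /=; first by rewrite hornerX expn0 expr1.
have u0 : 0 < w ^+ (2 ^ k) by rewrite exprn_gt0.
have -> : (dbl_poly k ^+ 2 - 2%:P).[x] = (w ^+ (2 ^ k)) ^+ 2 + (w ^+ (2 ^ k)) ^- 2.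
  rewrite hornerD hornerN horner_exp hornerC -real_normK ?num_real// IH.
  by field; rewrite gt_eqF.
by rewrite expnSr exprM ger0_norm// addr_ge0 ?invr_ge0 ?exprn_ge0 ?ltW.
Qed.

(** One step [t |-> t^2 - 2] enlarges an excess over 2 by a factor of at most 5 while the result
    stays below 1, so an excess of [5^-k] grows to at most 1 in [k] steps. *)
Lemma dbl_poly_le k x : `|x| <= 2 + 5 ^- k -> `|(dbl_poly k).[x]| <= 3.
Proof.
move=> xk; suff H j : (j <= k)%N -> `|(dbl_poly j).[x]| <= 2 + 5 ^- (k - j).
  by apply: le_trans (H k (leqnn k)) _; rewrite subnn expr0 invr1; lra.
elim: j => [|j IH] jk /=; first by rewrite hornerX subn0.
have := IH (ltnW jk); rewrite -(subSS j k) subSn//.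
have d0 : 0 < 5 ^- (k - j.+1) :> R by rewrite invr_gt0 exprn_gt0.
have d1 : 5 ^- (k - j.+1) <= 1 :> R by rewrite invf_le1 ?exprn_gt0// exprn_ege1// ler1n.
rewrite exprS invfM hornerD hornerN horner_exp hornerC.
move: (5 ^- _) d0 d1 => d d0 d1; rewrite ![`|_| <= _]ler_norml => /andP[t1 t2].
set t := _.[x] in t1 t2 *; have t3 : 0 <= t ^+ 2 by exact: sqr_ge0.
apply/andP; split; first by lra.
have : `|t| <= 2 + d / 5 by rewrite ler_norml; lra.
rewrite -ler_sqr ?nnegrE ?real_normK ?num_real//; [nra|lra].
Qed.

End doubling_poly.

(** * Growth of the orthonormal polynomials far from the support *)

Section exterior_growth.
Context {R : realType} (L : {scalar {poly R}}) (q : nat -> {poly R}).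
Context (size_q : forall n, size (q n) = n.+1).
Context (lead_q : forall n, 0 < lead_coef (q n)).
Context (orth_q : forall n m, L (q n * q m) = (n == m)%:R).
Context (S : set R) (M : R).
Context (L_ge0 : forall P : {poly R}, (forall x, S x -> 0 <= P.[x]) -> 0 <= L P).
Context (SM : forall x, S x -> `|x| <= M) (M1 : 1 <= M).
Context (outliers : forall d : R, 0 < d -> exists s : seq R,
  {in s, forall x, `|x| <= M} /\ forall x, S x -> `|x| <= 2 + d \/ x \in s).

Implicit Types (x w : R).

Local Notation a := (jac_a L q).
Local Notation b := (jac_b L q).

(** Cauchy-Schwarz for the coefficients of [P] in the basis [q], read off from the nonnegative sum
    of squares of [c k - p / K * (q k).[x]]. *)
Lemma christoffel_le n (P : {poly R}) x : (size P <= n.+1)%N -> 0 < `|(q n).[x]| ->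
  P.[x] ^+ 2 <= L (P ^+ 2) * \sum_(k < n.+1) (q k).[x] ^+ 2.
Proof.
move=> /(size_span q size_q lead_q)[c ->] qn; rewrite (L_span_sqr _ _ orth_q).
set K := \sum_(k < n.+1) (q k).[x] ^+ 2.
have K0 : 0 < K.
  rewrite /K big_ord_recr /= ltr_wpDl ?sumr_ge0//; first by move=> *; exact: sqr_ge0.
  by rewrite -real_normK ?num_real// exprn_gt0.
set p := _.[x]; have pE : p = \sum_(k < n.+1) c k * (q k).[x].
  by rewrite /p horner_sum; apply: eq_bigr => k _; rewrite hornerZ.
have : 0 <= \sum_(k < n.+1) (c k - p / K * (q k).[x]) ^+ 2.
  by apply: sumr_ge0 => *; exact: sqr_ge0.
have -> : \sum_(k < n.+1) (c k - p / K * (q k).[x]) ^+ 2 =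
    \sum_(k < n.+1) c k ^+ 2 - 2 * (p / K) * p + (p / K) ^+ 2 * K.
  rewrite {3}pE !mulr_sumr -sumrN -!big_split; apply: eq_bigr => k _ /=; ring.
have -> : 2 * (p / K) * p = 2 * (p ^+ 2 / K) by ring.
have -> : (p / K) ^+ 2 * K = p ^+ 2 / K by field; rewrite gt_eqF.
move=> h; rewrite -ler_pdivrMr//; lra.
Qed.

Lemma L1_gt0 : 0 < L 1.
Proof.
have /size1_polyC q0 : (size (q 0%N) <= 1)%N by rewrite size_q.
have c0 : 0 < (q 0%N)`_0 by have := lead_q 0; rewrite lead_coefE size_q.
have := orth_q 0 0; rewrite q0 -polyCM -alg_polyC linearZ /= => h.
have : 0 < (q 0%N)`_0 * (q 0%N)`_0 * L 1 by rewrite h ltr01.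
by rewrite pmulr_rgt0// mulr_gt0.
Qed.

Lemma prod_outliers_le (s : seq R) x : {in s, forall x, `|x| <= M} -> `|x| <= M ->
  `|(\prod_(i <- s) ('X - i%:P)).[x]| <= (2 * M) ^+ size s.
Proof.
elim: s => [|i s IH] sM xM; first by rewrite big_nil hornerC normr1.
rewrite big_cons hornerM normrM exprS !hornerE; apply: ler_pM => //.
  apply: le_trans (ler_normB _ _) _; have := sM i (mem_head _ _); lra.
by apply: IH => // j js; apply: sM; rewrite inE js orbT.
Qed.

Lemma prod_outliers_ge (s : seq R) x : {in s, forall x, `|x| <= M} -> 4 * M <= `|x| :> R ->
  1 <= `|(\prod_(i <- s) ('X - i%:P)).[x]| :> R.
Proof.
elim: s => [|i s IH] sM xM; first by rewrite big_nil hornerC normr1.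
rewrite big_cons hornerM normrM !hornerE -[leLHS]mulr1; apply: ler_pM; rewrite ?ler01//.
  have M1' := M1; apply: (@le_trans _ _ (4 * M - M)); first by lra.
  by apply: le_trans (lerB_dist _ _); apply: lerB => //; exact/sM/mem_head.
by apply: IH => // j js; apply: sM; rewrite inE js orbT.
Qed.

(** The linear factors kill the finitely many support points away from [[-2, 2]]; on the rest of the
    support the Chebyshev factor is at most [3 ^+ j], while at [x] it exceeds [w ^+ (2 ^ k * j)]. *)
Lemma test_poly_bound (s : seq R) k j x w : {in s, forall x, `|x| <= M} ->
  (forall x, S x -> `|x| <= 2 + 5 ^- k \/ x \in s) ->
  0 < w -> 4 * M <= w -> `|x| = w + w^-1 ->
  let Q := \prod_(i <- s) ('X - i%:P) * dbl_poly k ^+ j in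
  [/\ (size Q <= (size s + 2 ^ k * j).+1)%N, (w ^+ (2 ^ k * j)) ^+ 2 <= Q.[x] ^+ 2 &
      L (Q ^+ 2) <= ((2 * M) ^+ size s) ^+ 2 * 9 ^+ j * L 1].
Proof.
move=> sM sS w0 wM xw Q; have M1' := M1; split.
- apply: leq_trans (size_polyMleq _ _) _; rewrite size_prod_XsubC addSn /= -addnS leq_add2l.
  apply: leq_trans (size_poly_exp_leq _ _) _; rewrite ltnS leq_mul2r.
  by rewrite -subn1 leq_subLR add1n size_dbl_poly orbT.
- rewrite -[leRHS]real_normK ?num_real// ler_sqr ?nnegrE ?exprn_ge0 ?(ltW w0)//.
  rewrite hornerM horner_exp normrM normrX -[leLHS]mul1r; apply: ler_pM => //.
  - by rewrite exprn_ge0 ?ltW.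
  - apply: prod_outliers_ge => //; rewrite xw; have wi : 0 < w^-1 by rewrite invr_gt0.
    lra.
  rewrite exprM (dbl_poly_joukowski _ _ w)//; apply: lerXn2r.
  - by rewrite nnegrE exprn_ge0 ?(ltW w0).
  - by rewrite nnegrE addr_ge0 ?invr_ge0 ?exprn_ge0 ?(ltW w0).
  - by rewrite lerDl invr_ge0 exprn_ge0 ?(ltW w0).
rewrite -subr_ge0 -linearZ -linearN -linearD; apply: L_ge0 => y Sy.
rewrite !hornerE subr_ge0 -[leLHS]real_normK ?num_real//.
have -> : 9 ^+ j = (3 ^+ j) ^+ 2 :> R by rewrite -exprM mulnC exprM; congr (_ ^+ j); ring.
have M20 : 0 <= 2 * M by lra.
rewrite -exprMn ler_sqr ?nnegrE//; last by rewrite mulr_ge0 ?exprn_ge0.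
rewrite normrM normrX.
case: (sS y Sy) => [yk|ys].
  apply: ler_pM; rewrite ?exprn_ge0 ?prod_outliers_le ?SM//.
  by rewrite lerXn2r ?nnegrE ?dbl_poly_le.
have -> : (\prod_(i <- s) ('X - i%:P)).[y] = 0.
  by apply/eqP; rewrite -/(root _ _) root_prod_XsubC.
by rewrite normr0 mul0r mulr_ge0 ?exprn_ge0.
Qed.

(** The Christoffel inequality for the test polynomial bounds a sum of squares below, and doubling
    replaces that sum by [2 * |(q n).[x]|^2]. *)
Lemma exterior_growth x w : 1 < w -> 4 * M <= w -> `|x| = w + w^-1 ->
  (forall k, 0 < `|(q k).[x]|) -> (forall k, 2 * `|(q k).[x]| <= `|(q k.+1).[x]|) ->
  forall e : R, 0 < e -> exists n0, forall n, (n0 <= n)%N ->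
    (ln w - e) * n%:R <= ln `|(q n).[x]|.
Proof.
move=> w1 wM xw q_gt0 q2 e e0; have w0 : 0 < w by lra.
have M1' := M1.
(* With [2^k >= 4 / e] and [2^k * j <= n], the factor [9 ^+ j] contributes at most [4 j <= e n] to
   the logarithm. *)
have [k hk] : exists k, 4 / e <= (2 ^ k)%:R.
  exists (Num.truncn (4 / e)).+1; apply: ltW; apply: lt_le_trans (truncnS_gt _) _.
  by rewrite ler_nat ltnW// ltn_expl.
have [s [sM sS]] := outliers (5 ^- k) (ltac:(by rewrite invr_gt0 exprn_gt0)).
pose D := (2 ^ k)%N; have D0 : (0 < D)%N by rewrite expn_gt0.
pose C := 2 * (((2 * M) ^+ size s) ^+ 2 * L 1).
have C0 : 0 < C.
  by rewrite mulr_gt0// mulr_gt0 ?L1_gt0// !exprn_gt0//; lra.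
pose B := (size s + D)%:R * ln w + ln C / 2.
have lnw : 0 < ln w by rewrite ln_gt0.
exists (maxn (size s) (Num.truncn (B / (e / 2))).+1) => n; rewrite geq_max => /andP[ns nB].
have {}nB : B <= e / 2 * n%:R.
  rewrite -ler_pdivrMl ?divr_gt0// [_^-1 * _]mulrC.
  by apply: ltW; apply: lt_le_trans (truncnS_gt _) _; rewrite ler_nat.
(* The largest power keeping the degree of the test polynomial at most [n]; fewer than [size s + D]
   degrees are lost, which [B] accounts for. *)
pose j := ((n - size s) %/ D)%N.
have jn : (size s + D * j <= n)%N.
  by rewrite mulnC -[leqRHS](subnKC ns) leq_add2l leq_divM.
have nj : (n <= size s + D + D * j)%N.
  rewrite -{1}(subnKC ns) -addnA leq_add2l {1}(divn_eq (n - size s) D) addnC mulnC leq_add2r.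
  by rewrite ltnW// ltn_mod.
clearbody j; have [sQ Qx LQ] := test_poly_bound s k j x w sM sS w0 wM xw.
have Q1 := christoffel_le n _ x (leq_trans sQ _) (q_gt0 n).
have {}Q1 := le_trans Qx (Q1 _).
have K2 : \sum_(i < n.+1) (q i).[x] ^+ 2 <= 2 * `|(q n).[x]| ^+ 2.
  apply: le_trans (sum_sqr_doubling (fun i => `|(q i).[x]|) n q_gt0 q2).
  by apply: ler_sum => i _; rewrite real_normK ?num_real.
have : (w ^+ (D * j)) ^+ 2 <= C * 9 ^+ j * `|(q n).[x]| ^+ 2.
  apply: le_trans (Q1 _) _; first by rewrite ltnS.
  apply: le_trans (ler_pM _ _ LQ K2) _.
  - by apply: L_ge0 => z _; rewrite horner_exp sqr_ge0.
  - by apply: sumr_ge0 => i _; exact: sqr_ge0.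
  by rewrite /C le_eqVlt; apply/orP; left; apply/eqP; ring.
have W0 : 0 < w ^+ (D * j) by rewrite exprn_gt0.
have N0 : 0 < 9 ^+ j :> R by rewrite exprn_gt0.
have q0 := q_gt0 n; have Q0 : 0 < `|(q n).[x]| ^+ 2 by rewrite exprn_gt0.
have CN0 : 0 < C * 9 ^+ j by rewrite mulr_gt0.
rewrite -ler_ln ?posrE ?(mulr_gt0 CN0 Q0) ?exprn_gt0// (lnM CN0 Q0) (lnM C0 N0).
rewrite (lnXn _ W0) (lnXn _ w0) (lnXn _ q0) (lnXn _ (ltr0Sn R 8)).
rewrite -(mulr_natl (ln w)) -(mulr_natl (ln 9)) -(mulr_natl (ln `|_|)) => h.
have ln9 : ln 9 <= 4 :> R.
  have -> : 9 = 3 ^+ 2 :> R by ring.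
  by rewrite lnXn//; have := ln_le_sub1 (3 : R); rewrite -(mulr_natl (ln 3)); lra.
have j2 : j%:R * 4 <= e * n%:R.
  rewrite -[4](divfK (lt0r_neq0 e0)) mulrA mulrC; apply: ler_wpM2l; first exact: ltW.
  apply: (@le_trans _ _ ((D * j)%:R)); last by rewrite ler_nat (leq_trans (leq_addl _ _) jn).
  by rewrite mulnC natrM; apply: ler_wpM2l.
have jl : j%:R * ln 9 <= j%:R * 4 :> R by apply: ler_wpM2l.
have nj' : n%:R * ln w <= ((size s + D)%:R + (D * j)%:R) * ln w.
  by rewrite ler_pM2r// -natrD ler_nat.
by rewrite /B in nB; lra.
Qed.

Context (lead_small : forall e : R, 0 < e -> exists n0, forall n, (n0 <= n)%N ->
  ln (lead_coef (q n)) <= e * n%:R).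

Lemma eventually_le_linear (c e : R) : 0 < e ->
  exists n0, forall n, (n0 <= n)%N -> c <= e * n%:R.
Proof.
move=> e0; exists (Num.truncn (c / e)).+1 => n cn.
rewrite -ler_pdivrMl// [_^-1 * _]mulrC.
by apply: ltW; apply: lt_le_trans (truncnS_gt _) _; rewrite ler_nat.
Qed.

Lemma sum_ln_jac_a n : \sum_(k < n) ln (a k) = ln (lead_coef (q 0)) - ln (lead_coef (q n)).
Proof.
elim: n => [|n IH]; first by rewrite big_ord0 subrr.
by rewrite big_ord_recr /= IH lead_q_ratio// ln_div ?posrE//; ring.
Qed.

Lemma sum_ln_jac_a_ge (e : R) : 0 < e -> exists n0, forall n, (n0 <= n)%N ->
  - e * n%:R <= \sum_(k < n) ln (a k).
Proof.
move=> e0; have e20 : 0 < e / 2 by rewrite divr_gt0.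
have [n1 H1] := lead_small _ e20.
have [n2 H2] := eventually_le_linear (- ln (lead_coef (q 0))) _ e20.
exists (maxn n1 n2) => n; rewrite geq_max => /andP[/H1 {}H1 /H2 {}H2].
rewrite sum_ln_jac_a; lra.
Qed.

Lemma jac_cesaro_null : cesaro_null (fun k => b k ^+ 2 + 2 * (a k - 1) ^+ 2).
Proof.
have M1' := M1; have M0 : 0 < M by lra.
have a_gt0 k : 0 < a k by exact: jac_a_gt0.
have a_le k : a k <= M by exact: (jac_a_le _ _ orth_q S).
have b_le k : `|b k| <= M by exact: (jac_b_le _ _ orth_q S).
have aM k : 0 < a k <= M by rewrite a_gt0 a_le.
have nb_le k : `|(- b) k| <= M by rewrite fctE normrN.
apply: (jacobi_cesaro_null a b M) => // [|w e w1 wM e0]; first exact: sum_ln_jac_a_ge.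
pose y := w + w^-1; rewrite -/y; have w0 : 0 < w by lra.
have wi0 : 0 < w^-1 by rewrite invr_gt0.
have My : 4 * M <= y by rewrite /y; lra.
have y0 : 0 < y by lra.
have piv b' k : (forall k, `|b' k| <= M) -> 0 < pivot a b' y k /\ 2 * M <= pivot a b' y k.
  by move=> b'_le; have /andP[] := pivot_bounds a b' M y k M0 My aM b'_le; split; lra.
have rec0 x : a 0%N * (q 1%N).[x] = (x - b 0%N) * (q 0%N).[x].
  have := congr1 (horner^~ x) (jacobi_rec0 _ _ size_q lead_q orth_q).
  by rewrite !hornerE; lra.
have recS x k : x * (q k.+1).[x] =
    a k.+1 * (q k.+2).[x] + b k.+1 * (q k.+1).[x] + a k * (q k).[x].
  have := congr1 (horner^~ x) (jacobi_recS _ _ size_q lead_q orth_q k).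
  by rewrite !hornerE.
have q0_gt0 x : 0 < (q 0%N).[x].
  have /size1_polyC -> : (size (q 0%N) <= 1)%N by rewrite size_q.
  by have := lead_q 0; rewrite lead_coefE size_q hornerC.
(* The signs turn the recurrence at [- y] into the recurrence at [y] with [b] negated, so [r'] grows
   by the pivots of [- b]. *)
pose r k := (q k).[y]; pose r' k := (-1) ^+ k * (q k).[- y].
have r'0 : 0 < r' 0%N by rewrite /r' expr0 mul1r.
have r'rec0 : a 0%N * r' 1%N = (y - (- b) 0%N) * r' 0%N.
  by rewrite /r' expr0 expr1 mulrCA rec0 fctE; ring.
have r'recS k : y * r' k.+1 = a k.+1 * r' k.+2 + (- b) k.+1 * r' k.+1 + a k * r' k.
  by have := recS (- y) k; rewrite /r' !exprS fctE => h; ring: h.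
have pb k : 0 < pivot a b y k by have [] := piv b k b_le.
have pnb k : 0 < pivot a (- b) y k by have [] := piv (- b) k nb_le.
have r_ratio := pivot_ratio _ _ _ r a_gt0 pb (q0_gt0 y) (rec0 y) (recS y).
have r'_ratio := pivot_ratio _ _ _ r' a_gt0 pnb r'0 r'rec0 r'recS.
have E k : `|(q k).[y]| = r k by rewrite gtr0_norm//; have [] := r_ratio k.
have E' k : `|(q k).[- y]| = r' k.
  have [r'k _] := r'_ratio k; rewrite -(gtr0_norm r'k) /r' normrM.
  by rewrite normrX normrN1 expr1n mul1r.
have e40 : 0 < e / 8 by rewrite divr_gt0.
have yw : `|y| = w + w^-1 by rewrite gtr0_norm.
have yw' : `|- y| = w + w^-1 by rewrite normrN gtr0_norm.
have [||n1 H1] := exterior_growth y w w1 wM yw _ _ (e / 8) e40.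
- by move=> k; rewrite E; have [] := r_ratio k.
- move=> k; rewrite !E; apply: (pivot_growth _ _ _ r a_gt0 pb (q0_gt0 y) (rec0 y) (recS y)) => //.
  by move=> j; have [] := piv b j b_le.
have [||n2 H2] := exterior_growth (- y) w w1 wM yw' _ _ (e / 8) e40.
- by move=> k; rewrite E'; have [] := r'_ratio k.
- move=> k; rewrite !E'; apply: (pivot_growth _ _ _ r' a_gt0 pnb r'0 r'rec0 r'recS) => //.
  by move=> j; have [] := piv (- b) j nb_le.
have [n3 H3] := sum_ln_jac_a_ge _ e40.
have [n4 H4] := eventually_le_linear (ln (r 0%N) + ln (r' 0%N)) _ e40.
exists (maxn (maxn n1 n2) (maxn n3 n4)) => n; rewrite !geq_max.
move=> /andP[/andP[/H1 {}H1 /H2 {}H2] /andP[/H3 {}H3 /H4 {}H4]].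
have -> : \sum_(k < n) ln (pivot a b y k * pivot a (- b) y k) =
    \sum_(k < n) ln (pivot a b y k) + \sum_(k < n) ln (pivot a (- b) y k).
  by rewrite -big_split; apply: eq_bigr => k _; rewrite lnM ?posrE.
rewrite (sum_ln_pivot _ _ _ r a_gt0 pb (q0_gt0 y) (rec0 y) (recS y)).
rewrite (sum_ln_pivot _ _ _ r' a_gt0 pnb r'0 r'rec0 r'recS).
rewrite E in H1; rewrite E' in H2; have n0 : 0 <= e * n%:R by rewrite mulr_ge0// ltW.
lra.
Qed.

End exterior_growth.

(** * Christoffel-Darboux formula and kernel bound *)

Section christoffel_darboux.
Context {R : realType} (L : {scalar {poly R}}) (q : nat -> {poly R}).
Context (size_q : forall n, size (q n) = n.+1).
Context (lead_q : forall n, 0 < lead_coef (q n)).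
Context (orth_q : forall n m, L (q n * q m) = (n == m)%:R).
Implicit Types (f g : nat -> R).

Local Notation a := (jac_a L q).
Local Notation b := (jac_b L q).

Definition jac_op f k :=
  a k * f k.+1 + b k * f k + (if k is m.+1 then a m * f m else 0).

(** Summation by parts: the symmetry of the Jacobi matrix cancels all terms except those joining [n]
    and [n + 1]. As [f] is arbitrary, the formula applies separately to the real and imaginary parts
    of [q_k(z)]. *)
Lemma christoffel_darboux f n :
  'X * (\sum_(k < n.+1) f k *: q k) - \sum_(k < n.+1) jac_op f k *: q k =
  a n *: (f n *: q n.+1 - f n.+1 *: q n).
Proof.
elim: n => [|n IH].
  rewrite !big_ord1 -scalerAr (jacobi_rec0 _ _ size_q lead_q orth_q) /jac_op.
  rewrite -!mul_polyC !polyCD !polyCM; ring.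
rewrite big_ord_recr [in X in _ - X]big_ord_recr /=.
rewrite mulrDr opprD addrACA IH -scalerAr (jacobi_recS _ _ size_q lead_q orth_q) /jac_op.
rewrite -!mul_polyC !polyCD !polyCM; ring.
Qed.

Lemma L_two_terms n (x y : R) :
  L ((a n *: (x *: q n.+1 - y *: q n)) ^+ 2) = a n ^+ 2 * (x ^+ 2 + y ^+ 2).
Proof.
have -> : (a n *: (x *: q n.+1 - y *: q n)) ^+ 2 = (a n ^+ 2) *:
   (x ^+ 2 *: (q n.+1 * q n.+1) - (2 * x * y) *: (q n.+1 * q n) + y ^+ 2 *: (q n * q n)).
  by rewrite -!mul_polyC !expr2 !polyCM !polyCD; ring.
rewrite linearZ /= linearD linearB !linearZ /= !orth_q !eqxx gtn_eqF// mulr0n oppr0 scaler0 addr0.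
by rewrite !mulr1n !mulr1.
Qed.

Context (S : set R).
Context (L_ge0 : forall P : {poly R}, (forall x, S x -> 0 <= P.[x]) -> 0 <= L P).

(* [K = sum_k c_k q_k] with [c_k = f_k + i g_k = q_k(s + it)] is the
   Christoffel-Darboux kernel; its norm is compared with that of
   [(x - s - it) K(x)], which has only two terms. *)
Lemma kernel_bound (s t d : R) f g n : (forall x, S x -> d <= (x - s) ^+ 2 + t ^+ 2) ->
  (forall k, s * f k - t * g k = jac_op f k) ->
  (forall k, s * g k + t * f k = jac_op g k) ->
  d * \sum_(k < n.+1) (f k ^+ 2 + g k ^+ 2) <=
  a n ^+ 2 * (f n ^+ 2 + f n.+1 ^+ 2 + (g n ^+ 2 + g n.+1 ^+ 2)).
Proof.
move=> dS Hf Hg.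
pose A := \sum_(k < n.+1) f k *: q k; pose B := \sum_(k < n.+1) g k *: q k.
have U : ('X - s%:P) * A + t%:P * B = a n *: (f n *: q n.+1 - f n.+1 *: q n).
  rewrite -christoffel_darboux mulrBl -addrA; congr (_ + _).
  rewrite /A /B !mul_polyC !scaler_sumr -sumrN -big_split -sumrN; apply: eq_bigr => k _ /=.
  by rewrite -Hf -!mul_polyC !polyCB !polyCM; ring.
have V : ('X - s%:P) * B - t%:P * A = a n *: (g n *: q n.+1 - g n.+1 *: q n).
  rewrite -christoffel_darboux mulrBl -addrA; congr (_ + _).
  rewrite /A /B !mul_polyC !scaler_sumr -!sumrN -big_split; apply: eq_bigr => k _ /=.
  by rewrite -Hg -!mul_polyC !polyCD !polyCM; ring.
rewrite [leRHS]mulrDr -(L_two_terms n (f n)) -(L_two_terms n (g n)) -U -V -linearD /=.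
have -> : \sum_(k < n.+1) (f k ^+ 2 + g k ^+ 2) = L (A ^+ 2 + B ^+ 2).
  by rewrite big_split /= linearD /= !L_span_sqr.
rewrite -subr_ge0 -linearZ -linearB; apply: L_ge0 => x /dS dx.
rewrite !(hornerE, horner_exp) subr_ge0.
move: A.[x] B.[x] => A' B'.
have -> : ((x - s) * A' + t * B') ^+ 2 + ((x - s) * B' - t * A') ^+ 2 =
  ((x - s) ^+ 2 + t ^+ 2) * (A' ^+ 2 + B' ^+ 2) by ring.
by apply: ler_wpM2r => //; rewrite addr_ge0 ?sqr_ge0.
Qed.

End christoffel_darboux.

(** * The real-valued modulus on complex numbers *)

Section complex_modulus.
Context {R : realType}.
Implicit Types (x y : R[i]).

Local Notation nc := Normc.normc.

Lemma normc_ge0 x : 0 <= nc x.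
Proof. by case: x => s t /=; rewrite sqrtr_ge0. Qed.

Lemma normc_real (s : R) : nc s%:C = `|s|.
Proof. by rewrite /= expr0n addr0 sqrtr_sqr. Qed.

Lemma normc_sqr x : nc x ^+ 2 = complex.Re x ^+ 2 + complex.Im x ^+ 2.
Proof. by case: x => s t /=; rewrite sqr_sqrtr// addr_ge0 ?sqr_ge0. Qed.

Lemma normc_gt0 x : (0 < nc x) = (x != 0).
Proof.
rewrite lt0r normc_ge0 andbT; apply/idP/idP; apply: contra => /eqP.
  by move=> ->; rewrite Normc.normc0.
by move/Normc.eq0_normc ->.
Qed.

End complex_modulus.

(** * Ratio asymptotics for a perturbation of the free recurrence *)

Section ratio.
Context {R : realType} (a b : nat -> R) (c : nat -> R[i]) (z w : R[i]).
Local Notation nc := Normc.normc.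
Context (rec : forall k,
  z * c k.+1 = (a k.+1)%:C * c k.+2 + (b k.+1)%:C * c k.+1 + (a k)%:C * c k).
Context (w_gt1 : 1 < nc w) (zw : z = w + w^-1).

Local Notation E k := (c k - w^-1 * c k.+1).

(* A free solution (a = 1, b = 0) has [E k = w^-1 * E (k-1)], so [E] decays
   geometrically up to the size of the perturbation. *)
Lemma defect_decay m J (eta B : R) : (J <= m)%N -> 0 <= eta ->
  (forall k, (k <= m.+1)%N -> nc (c k) <= B) ->
  (forall k, (m - J <= k <= m)%N -> `|1 - a k| <= eta /\ `|b k| <= eta) ->
  nc (E m) <= (2 * (nc w)^-1 ^+ J + 3 * eta * J%:R) * B.
Proof.
move=> Jm eta0 cB ab.
have w0 : w != 0 by rewrite -normc_gt0; apply: lt_trans w_gt1.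
set r := (nc w)^-1.
have r0 : 0 <= r by rewrite invr_ge0 normc_ge0.
have r1 : r <= 1 by rewrite invf_le1 ?(lt_trans _ w_gt1)// ltW.
have B0 : 0 <= B by apply: le_trans (cB 0%N _) => //; exact: normc_ge0.
suff H i : (i <= J)%N -> nc (E (m - J + i)) <= (2 * r ^+ i + 3 * eta * i%:R) * B.
  by have := H J (leqnn J); rewrite subnK.
elim: i => [|i IH] iJ.
  rewrite addn0 expr0 mulr0 addr0 mulr1.
  apply: le_trans (le_normcD _ _) _; rewrite normcN Normc.normcM Normc.normcV -/r.
  have h1 : nc (c (m - J)%N) <= B by apply: cB; lia.
  have h2 : nc (c (m - J).+1) <= B by apply: cB; lia.
  have h3 := normc_ge0 (c (m - J).+1); nra.
have {}IH := IH (ltnW iJ).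
move: IH; rewrite addnS; set k := (m - J + i)%N => IH.
have kJ : (m - J <= k)%N by rewrite leq_addr.
have km : (k.+1 <= m)%N by rewrite /k; lia.
clearbody k.
(* By the recurrence, [e] equals [c k + c k.+2 - z * c k.+1], the failure of the free recurrence;
   each of its three terms is at most [eta * B]. *)
pose e := (1 - a k)%:C * c k + (1 - a k.+1)%:C * c k.+2 - (b k.+1)%:C * c k.+1.
have -> : E k.+1 = w^-1 * (E k - e).
  have h := rec k; rewrite zw in h.
  have D u : (1 - u)%:C = 1 - u%:C :> R[i] by rewrite rmorphB.
  have {}h : (a k)%:C * c k =
      (w + w^-1) * c k.+1 - (a k.+1)%:C * c k.+2 - (b k.+1)%:C * c k.+1 by rewrite h; ring.
  rewrite /e !D !mulrBl h; field; exact: w0.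
have [a1 _] : `|1 - a k| <= eta /\ `|b k| <= eta by apply: ab; rewrite kJ ltnW.
have [a2 b2] : `|1 - a k.+1| <= eta /\ `|b k.+1| <= eta by apply: ab; rewrite km leqW.
have c1 := cB k (leqW (ltnW km)).
have c2 := cB k.+1 (leqW km).
have c3 := cB k.+2 km.
have e_le : nc e <= 3 * eta * B.
  apply: le_trans (le_normcD _ _) _; rewrite normcN.
  apply: (@le_trans _ R (nc ((1 - a k)%:C * c k) + nc ((1 - a k.+1)%:C * c k.+2)
    + nc ((b k.+1)%:C * c k.+1))); first by rewrite lerD2r le_normcD.
  rewrite !Normc.normcM !normc_real.
  have h1 : `|1 - a k| * nc (c k) <= eta * B.
    exact: (ler_pM (normr_ge0 _) (normc_ge0 _) a1 c1).
  have h2 : `|1 - a k.+1| * nc (c k.+2) <= eta * B.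
    exact: (ler_pM (normr_ge0 _) (normc_ge0 _) a2 c3).
  have h3 : `|b k.+1| * nc (c k.+1) <= eta * B.
    exact: (ler_pM (normr_ge0 _) (normc_ge0 _) b2 c2).
  lra.
rewrite Normc.normcM Normc.normcV -/r.
have hE : nc (E k - e) <= nc (E k) + nc e by apply: le_trans (le_normcD _ _) _; rewrite normcN.
apply: le_trans (ler_wpM2l r0 hE) _; rewrite mulrDr.
have f1 : r * nc (E k) <= r * ((2 * r ^+ i + 3 * eta * i%:R) * B) by apply: ler_wpM2l.
have f2 : r * nc e <= 3 * eta * B.
  by apply: le_trans (ler_piMl _ r1) e_le; exact: normc_ge0.
have f3 : r * (3 * eta * i%:R * B) <= 3 * eta * i%:R * B.
  by apply: ler_piMl => //; rewrite !mulr_ge0.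
rewrite exprS -natr1; lra.
Qed.

Context (C : R) (C_gt0 : 0 < C) (c0 : c 0%N != 0).
Context (c_le : forall n k, (k <= n.+1)%N -> nc (c k) <= C * (nc (c n) + nc (c n.+1))).

Lemma ratio_cvg (N : set nat) :
  (forall j (e : R), 0 < e -> exists n0, forall n, (n0 <= n)%N -> N n ->
    b (n - j)%N ^+ 2 + 2 * (a (n - j)%N - 1) ^+ 2 <= e) ->
  forall e : R, 0 < e -> exists n0, forall n, (n0 <= n)%N -> N n ->
    nc (w * c n.-1 / c n - 1) <= e.
Proof.
move=> HN e e0.
have w0 : w != 0 by rewrite -normc_gt0; apply: lt_trans w_gt1.
set r := (nc w)^-1.
have r0 : 0 < r by rewrite invr_gt0 normc_gt0.
have r1 : r < 1 by rewrite invf_lt1 ?normc_gt0.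
have nw0 : 0 < nc w by rewrite normc_gt0.
have C0 := C_gt0.
(* The bound [d * C <= 1 / 2] will give [|c n| <= 3 |c n.+1|], and then [d * C <= e / (4 |w|)] the
   final estimate. [J] and [eta] spend one half of [d] each, on the geometric decay and on the
   perturbation accumulated over [J] steps. *)
pose d := Num.min (1 / 2) (e / (4 * nc w)) / C.
have d0 : 0 < d by rewrite divr_gt0// lt_min !divr_gt0// mulr_gt0.
have dC1 : d * C <= 1 / 2 by rewrite divfK ?gt_eqF// ge_min lexx.
have dC2 : d * C * (4 * nc w) <= e.
  by rewrite -ler_pdivlMr ?mulr_gt0// divfK ?gt_eqF// ge_min lexx orbT.
have [J rJ] : exists J, 2 * r ^+ J <= d / 2.
  have : r ^+ n @[n --> \oo] --> (0 : R) by apply: cvg_expr; rewrite ger0_norm ?ltW.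
  move=> /cvg0P/(_ (d / 4)); rewrite divr_gt0// => /(_ isT)[n0 /(_ n0 (leqnn _))].
  rewrite ger0_norm ?exprn_ge0 ?(ltW r0)// => h; exists n0; lra.
pose eta := d / (6 * J.+1%:R).
have eta0 : 0 < eta by rewrite divr_gt0// mulr_gt0.
have etaJ : 3 * eta * J%:R <= d / 2.
  have : eta * (6 * J.+1%:R) = d by rewrite divfK// mulf_neq0.
  by rewrite -natr1; have : 0 <= eta * J%:R by [rewrite mulr_ge0// ltW]; lra.
(* Only finitely many shifts matter, so a single threshold serves the whole window; it reaches
   [J.+1] because the defect is measured at the predecessor of the index in [N]. *)
have [n0 Hn0] : exists n0, forall n, (n0 <= n)%N -> N n -> forall j, (j <= J.+1)%N ->
    b (n - j)%N ^+ 2 + 2 * (a (n - j)%N - 1) ^+ 2 <= eta ^+ 2.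
  elim: (J.+1) => [|j [n1 H1]].
    have [n0 H] := HN 0%N _ (exprn_gt0 2 eta0).
    by exists n0 => n n0n Nn j; rewrite leqn0 => /eqP ->; exact: H.
  have [n0 H] := HN j.+1 _ (exprn_gt0 2 eta0).
  exists (maxn n0 n1) => n; rewrite geq_max => /andP[n0n n1n] Nn i.
  rewrite leq_eqVlt => /predU1P[->|]; first exact: H.
  by rewrite ltnS; apply: H1.
exists (maxn n0 J.+1) => n; rewrite geq_max => /andP[n0n Jn] Nn.
have {n0n Nn} Hn := Hn0 n n0n Nn; case: n Jn Hn => // n; rewrite ltnS => Jn Hn /=.
set B := C * (nc (c n) + nc (c n.+1)).
have B0 : 0 < B.
  by apply: lt_le_trans (c_le n 0 _) => //; rewrite normc_gt0.
have cB k : (k <= n.+1)%N -> nc (c k) <= B by exact: c_le.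
have ab k : (n - J <= k <= n)%N -> `|1 - a k| <= eta /\ `|b k| <= eta.
  move=> /andP[k1 k2]; have := Hn (n.+1 - k)%N.
  rewrite subKn; last by rewrite ltnW.
  have -> : (n.+1 - k <= J.+1)%N by move: k1 k2 Jn; clear; lia.
  move=> /(_ isT) h; have s1 := sqr_ge0 (b k); have s2 := sqr_ge0 (a k - 1).
  rewrite -[`|1 - a k|]distrC; split.
    by rewrite -ler_sqr ?nnegrE ?(ltW eta0)// real_normK ?num_real//; lra.
  by rewrite -ler_sqr ?nnegrE ?(ltW eta0)// real_normK ?num_real//; lra.
have K : nc (c n - w^-1 * c n.+1) <= d * B.
  apply: le_trans (defect_decay n J eta B Jn (ltW eta0) cB ab) _.
  apply: ler_wpM2r; first exact: ltW.
  by rewrite -/r; lra.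
have x0 := normc_ge0 (c n); have y0 := normc_ge0 (c n.+1).
have n1 : nc (c n) <= nc (c n - w^-1 * c n.+1) + r * nc (c n.+1).
  have -> : r * nc (c n.+1) = nc (w^-1 * c n.+1) by rewrite Normc.normcM Normc.normcV.
  by apply: le_trans (le_normcD _ _); rewrite subrK.
have ry : r * nc (c n.+1) <= nc (c n.+1) by rewrite ler_piMl// ltW.
have dB : d * B = d * C * (nc (c n) + nc (c n.+1)) by rewrite /B mulrA.
have dB2 : d * B <= 1 / 2 * (nc (c n) + nc (c n.+1)).
  by rewrite dB; apply: ler_wpM2r => //; rewrite addr_ge0.
have n3 : nc (c n) <= 3 * nc (c n.+1) by lra.
(* If [c n.+1] vanished, so would [c n] and hence [B], which is positive because [c 0] is
   nonzero. *)
have cn0 : 0 < nc (c n.+1).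
  rewrite lt0r y0 andbT; apply/negP => /eqP h; move: B0; rewrite /B h.
  have -> : nc (c n) = 0 by lra.
  by rewrite addr0 mulr0 ltxx.
have -> : w * c n / c n.+1 - 1 = w * (c n - w^-1 * c n.+1) / c n.+1.
  by field; rewrite w0 -normc_gt0 cn0.
rewrite !Normc.normcM Normc.normcV ler_pdivrMr//.
apply: (@le_trans _ R (nc w * (d * C * (4 * nc (c n.+1))))).
  apply: ler_wpM2l; first exact: ltW.
  apply: le_trans K _; rewrite dB; apply: ler_wpM2l; last by lra.
  by rewrite mulr_ge0 ?ltW.
have -> : nc w * (d * C * (4 * nc (c n.+1))) = d * C * (4 * nc w) * nc (c n.+1) by ring.
by apply: ler_wpM2r.
Qed.

End ratio.

(** * The conformal map as an inverse of the Joukowski map *)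

Section joukowski.
Context {R : realType}.
Implicit Types (z u v : R[i]).
Local Notation nc := Normc.normc.
Local Notation Re := complex.Re.
Local Notation Im := complex.Im.

Lemma Im_sqrtC_ge0 z : 0 <= Im (sqrtC z).
Proof. by rewrite -ler0c complexIm; apply: Im_rootC_ge0. Qed.

Lemma Re_sqrtC_ge0 z : Im (sqrtC z) = 0 -> 0 <= Re (sqrtC z).
Proof.
move=> h; have E : sqrtC z = (Re (sqrtC z))%:C by case: (sqrtC z) h => x y /= ->.
have : 0 <= sqrtC z.
  rewrite sqrtC_ge0 -[z](sqrtCK z) E -rmorphXn /= ler0c; exact: sqr_ge0.
by rewrite {1}E ler0c.
Qed.

Lemma Re_sqr z : Re (z ^+ 2) = Re z ^+ 2 - Im z ^+ 2.
Proof. by case: z => x y /=; rewrite !expr2. Qed.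

Lemma Im_sqr z : Im (z ^+ 2) = 2 * (Re z * Im z).
Proof. by case: z => x y /=; ring. Qed.

(** With [u] and [v] the two roots, [phi z = (u + v)^2 / 4], and [(v - u)(u + v) = 4] makes
    [(v - u)^2 / 4] its inverse. Thus [|phi z| > 1] means [|v - u| < |u + v|], that is, a positive
    real part for the product of [u] and the conjugate of [v]. *)
Lemma phi_joukowski z : (forall x : R, z = x%:C -> ~ (-2 <= x <= 2)) ->
  1 < nc (phi z) /\ z = phi z + (phi z)^-1.
Proof.
move=> zN; rewrite /phi; set u := sqrtC (z - 2); set v := sqrtC (z + 2).
have u2 : u ^+ 2 = z - 2 by rewrite sqrtCK.
have v2 : v ^+ 2 = z + 2 by rewrite sqrtCK.
have -> : (z + u * v) / 2 = (u + v) ^+ 2 / 4.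
  have -> : z = (u ^+ 2 + v ^+ 2) / 2 by rewrite u2 v2; field.
  by field.
have uv : v ^+ 2 - u ^+ 2 = 4 by rewrite u2 v2; ring.
have duv : (v - u) * (u + v) = 4 by rewrite -uv; ring.
have s0 : u + v != 0.
  apply/negP => /eqP h; have := duv.
  by rewrite h mulr0 => /esym/eqP; rewrite pnatr_eq0.
split; last first.
  apply: (mulIf (_ : 4 * (u + v) ^+ 2 != 0)).
    by rewrite mulf_neq0 ?expf_neq0// pnatr_eq0.
  have -> : z = (u ^+ 2 + v ^+ 2) / 2 by rewrite u2 v2; field.
  have E : ((v - u) * (u + v)) ^+ 2 = 16.
    by rewrite duv; ring.
  have -> : ((u + v) ^+ 2 / 4 + ((u + v) ^+ 2 / 4)^-1) * (4 * (u + v) ^+ 2) =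
      (u + v) ^+ 2 * (u + v) ^+ 2 + 16 by field.
  by rewrite -E; field.
have n4 : nc (4 : R[i]) = 4.
  have -> : (4 : R[i]) = (4 : R)%:C by rewrite rmorph_nat.
  by rewrite normc_real ger0_norm.
have N0 : 0 < nc (u + v) by rewrite normc_gt0.
suff [P0 P1] : 0 <= nc (v - u) /\ nc (v - u) < nc (u + v).
  rewrite Normc.normcM Normc.normcV n4 ltr_pdivlMr// mul1r expr2 Normc.normcM.
  rewrite -n4 -duv.
  by rewrite Normc.normcM ltr_pM2r.
split; first exact: normc_ge0.
rewrite -ltr_sqr ?nnegrE ?normc_ge0// !normc_sqr !raddfD !raddfN /=.
have uy0 := Im_sqrtC_ge0 (z - 2); have vy0 := Im_sqrtC_ge0 (z + 2).
have ux0 := Re_sqrtC_ge0 (z - 2); have vx0 := Re_sqrtC_ge0 (z + 2).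
rewrite -/u in uy0 ux0; rewrite -/v in vy0 vx0.
have two : 2 = 2%:C :> R[i] by rewrite rmorph_nat.
have zv : z = v ^+ 2 - 2%:C by rewrite v2 -two; ring.
have zu : z = u ^+ 2 + 2%:C by rewrite u2 -two; ring.
have e1 : Re z = Re v ^+ 2 - Im v ^+ 2 - 2 by rewrite {1}zv raddfB /= Re_sqr.
have e2 : Re z = Re u ^+ 2 - Im u ^+ 2 + 2 by rewrite {1}zu raddfD /= Re_sqr.
have e3 : Im z = 2 * (Re v * Im v) by rewrite {1}zv raddfB /= Im_sqr subr0.
have e4 : Im z = 2 * (Re u * Im u) by rewrite {1}zu raddfD /= Im_sqr addr0.
have zreal : Im z = 0 -> ~ (-2 <= Re z <= 2).
  by move=> h; apply: zN; case: (z) h => x y /= ->.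
suff : 0 < Re u * Re v + Im u * Im v by lra.
move: e1 e2 e3 e4 zreal uy0 vy0 ux0 vx0.
move: (Re z) (Im z) (Re u) (Im u) (Re v) (Im v) => rz iz ux uy vx vy.
move=> e1 e2 e3 e4 zreal uy0 vy0 ux0 vx0.
(* If [u] is real then so is [v], and both are positive; [v] real without [u] would put [z] in
   [[-2, 2]]. Otherwise both imaginary parts are positive and [ux * uy = vx * vy] gives [ux] and
   [vx] compatible signs. *)
have [uy1|uy1] := eqVneq uy 0.
  have {}ux0 := ux0 uy1; have iz0 : iz = 0 by rewrite e4 uy1; lra.
  have : vx * vy = 0 by lra.
  move/eqP; rewrite mulf_eq0 => /orP[] /eqP v1.
    by exfalso; rewrite v1 uy1 in e1 e2; have := sqr_ge0 ux; have := sqr_ge0 vy; lra.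
  have {}vx0 := vx0 v1; have {}zreal := zreal iz0.
  rewrite uy1 v1 in e1 e2 *.
  have ux1 : ux != 0 by apply/eqP => h; apply: zreal; rewrite e2 h; lra.
  have vx1 : vx != 0.
    by apply/eqP => h; rewrite h in e1; have := sqr_ge0 ux; lra.
  by rewrite mulr0 addr0 mulr_gt0// lt0r ?ux1 ?vx1.
have uy2 : 0 < uy by rewrite lt0r uy1.
have [vy1|vy1] := eqVneq vy 0.
  have iz0 : iz = 0 by rewrite e3 vy1; lra.
  have : ux * uy = 0 by lra.
  move/eqP; rewrite mulf_eq0 (negbTE uy1) orbF => /eqP ux1.
  exfalso; apply: (zreal iz0); rewrite ux1 vy1 in e1 e2.
  have := sqr_ge0 uy; have := sqr_ge0 vx; lra.
have vy2 : 0 < vy by rewrite lt0r vy1.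
have uvy : 0 < uy * vy by rewrite mulr_gt0.
suff : 0 <= ux * vx by lra.
rewrite -(pmulr_lge0 _ uvy).
have -> : ux * vx * (uy * vy) = (ux * uy) * (vx * vy) by ring.
have -> : ux * uy = vx * vy by lra.
by rewrite -expr2 sqr_ge0.
Qed.

End joukowski.

(** * Logarithmic potentials under pullback by [x |-> x^2 - 2] *)

Section capacity_lower_bound.
Context {R : realType}.
Implicit Types (nu : probability (measurableTypeR R) R) (x y t : R).

(** Monotonicity follows from the definition of the integral by suprema over simple functions,
    without measurability; it thus applies to the inner integral of [log_energy] as a function of
    [x]. *)
Lemma le_integral_total d (T : measurableType d) (m : {measure set T -> \bar R})
    (f g : T -> \bar R) : (forall z, f z <= g z)%E ->
  (\int[m]_x f x <= \int[m]_x g x)%E.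
Proof.
move=> fg; rewrite /integral !patch_setT; apply: leeB; apply: le_ereal_sup => _ [h /= hf <-];
  exists h => //= x; apply: le_trans (hf x) _.
  by apply: (@funepos_le _ _ setT) => [? _|]; [exact: fg|rewrite inE].
by apply: (@funeneg_le _ _ setT) => [? _|]; [exact: fg|rewrite inE].
Qed.

(* The constant [ln 4] makes the kernel nonnegative on [-2, 2]; outside
   [-2, 2], where the measures below have no mass, the value +oo makes the
   inequalities between kernels hold everywhere. *)
Definition log_kernel x y : \bar R :=
  if (-2 <= y <= 2) && (x != y) then (ln 4 - ln `|x - y|)%:E else +oo%E.

Lemma log_kernel_ge0 x y : -2 <= x <= 2 -> (0 <= log_kernel x y)%E.
Proof.
move=> /andP[x1 x2]; rewrite /log_kernel; case: ifPn => // /andP[/andP[y1 y2] xy].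
rewrite lee_fin subr_ge0 ler_ln ?posrE ?normr_gt0 ?subr_eq0// ler_norml; lra.
Qed.

Lemma measurable_log_kernel x :
  measurable_fun setT (log_kernel x : measurableTypeR R -> \bar R).
Proof.
rewrite /log_kernel; apply: measurable_fun_ifT => //=.
  apply: measurable_and.
    apply: measurable_and; exact: measurable_fun_ler.
  apply: measurable_neg; exact: measurable_fun_eqr.
apply/measurable_EFinP; apply: measurable_funB => //; apply: measurableT_comp => //.
apply: measurableT_comp => //; exact: measurable_funB.
Qed.

Lemma lne_le_log_kernel x y : (- lne `|x - y|%:E <= log_kernel x y - (ln 4)%:E)%E.
Proof.
rewrite /log_kernel; case: ifPn => [/andP[_ xy]|_]; last by rewrite addye// leey.
by rewrite lne_EFin ?normr_gt0 ?subr_eq0// -EFinB -EFinN lee_fin; lra.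
Qed.

(** The measure charges only [[-2, 2]], so a pointwise bound on the potential there bounds its
    integral; the total mass 1 removes the constant [ln 4]. *)
Lemma log_energy_le nu (C : R) : nu (~` `[-2, 2]%classic) = 0%E ->
  (forall x, -2 <= x <= 2 ->
    (\int[nu]_y log_kernel x y <= (ln 4 + C)%:E)%E) ->
  0 <= C -> (log_energy nu <= C%:E)%E.
Proof.
move=> nu0 nuC C0; rewrite /log_energy.
pose g x := if -2 <= x <= 2 then C%:E else +oo%E.
apply: (@le_trans _ _ (\int[nu]_x g x)%E).
  apply: le_integral_total => x; rewrite /g; case: ifPn => [xD|_]; last by rewrite leey.
  apply: (@le_trans _ _ (\int[nu]_y (log_kernel x y - (ln 4)%:E))%E).
    by apply: le_integral_total => y; exact: lne_le_log_kernel.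
  have k0 y : (0 <= log_kernel x y)%E by exact: log_kernel_ge0.
  have ki : nu.-integrable setT (log_kernel x).
    apply/integrableP; split; first exact: measurable_log_kernel.
    under eq_integral do rewrite gee0_abs//.
    exact: le_lt_trans (nuC x xD) (ltry _).
  rewrite integralB//=; last exact: finite_measure_integrable_cst.
  have -> : (\int[nu]_y (ln 4)%:E = (ln 4)%:E)%E.
    rewrite (integral_cst _ measurableT) -[RHS]mule1; congr (_ * _)%E.
    exact: probability_setT.
  by rewrite leeBlDr// -EFinD [C + _]addrC; exact: nuC.
have mI : measurable (`[-2, 2]%classic : set (measurableTypeR R)) by exact: measurable_itv.
have mg : measurable_fun [set: measurableTypeR R] g.
  rewrite /g; apply: measurable_fun_ifT => //.
  by apply: measurable_and; exact: measurable_fun_ler.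
rewrite -(setUv `[-2, 2]%classic) ge0_integral_setU//=.
- rewrite [X in (_ + X)%E]null_set_integral//; first last.
  + exact: measurable_funTS.
  + exact: measurableC.
  rewrite adde0 (eq_integral (cst C%:E)); last first.
    by move=> x; rewrite inE /= in_itv /= /g => ->.
  rewrite integral_cst// -[leRHS]mule1; apply: lee_wpmul2l => //.
  exact: probability_le1.
- exact: measurableC.
- exact: measurable_funTS.
- by move=> x _; rewrite /g; case: ifPn => // _; rewrite lee_fin.
- exact/disj_setPCl.
Qed.

(** The two inverse branches of [x |-> x^2 - 2], with [s] choosing the sign; below [-2] both take
    the default value 0. *)
Definition fold_branch (s : bool) (t : measurableTypeR R) : measurableTypeR R :=
  (-1) ^+ s * Num.sqrt (t + 2).

Lemma measurable_fold_branch s : measurable_fun setT (fold_branch s).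
Proof.
apply: measurable_funM => //; apply: measurableT_comp => //.
  by apply: continuous_measurable_fun; exact: sqrt_continuous.
exact: measurable_funD.
Qed.

HB.instance Definition _ s := isMeasurableFun.Build _ _ _ _ (fold_branch s)
  (measurable_fold_branch s).

Definition half_nng : {nonneg R} := (2^-1)%:nng.

(** The balanced pullback of [nu]: the mass at [t] is shared equally between the two preimages of
    [t]. *)
Definition fold_measure (nu : probability (measurableTypeR R) R) :
    set (measurableTypeR R) -> \bar R :=
  measure_add (mscale half_nng (distribution nu (fold_branch false)))
              (mscale half_nng (distribution nu (fold_branch true))).

HB.instance Definition _ nu := Measure.on (fold_measure nu).

Lemma fold_measureE nu A : fold_measure nu A =
  (2^-1%:E * nu (fold_branch false @^-1` A) + 2^-1%:E * nu (fold_branch true @^-1` A))%E.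
Proof. by rewrite /fold_measure measure_addE. Qed.

Lemma fold_measure_setT nu : fold_measure nu setT = 1%E.
Proof.
rewrite fold_measureE !preimage_setT -ge0_muleDl ?lee_fin//.
rewrite -EFinD (_ : 2^-1 + 2^-1 = 1 :> R); last by lra.
by rewrite mul1e; exact: probability_setT.
Qed.

HB.instance Definition _ nu := Measure_isProbability.Build _ _ R (fold_measure nu)
  (fold_measure_setT nu).

Lemma integral_fold_measure nu (f : measurableTypeR R -> \bar R) :
  measurable_fun setT f -> (forall y, 0 <= f y)%E ->
  (\int[fold_measure nu]_y f y =
   2^-1%:E * \int[nu]_t (f (fold_branch false t) + f (fold_branch true t)))%E.
Proof.
move=> mf f0; rewrite ge0_integral_measure_add// !ge0_integral_mscale//.
rewrite !ge0_integral_distribution//.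
have I0 s : (0 <= \int[nu]_t (f \o fold_branch s) t)%E.
  by apply: integral_ge0 => t _; exact: f0.
rewrite -ge0_muleDr ?I0//; congr (_ * _)%E.
rewrite ge0_integralD//; apply: measurableT_comp => //; exact: measurable_fold_branch.
Qed.

(** For [s^2 = t + 2], the product [(x - s) (x + s)] is [(x^2 - 2) - t], so the two logarithms add
    up to the one at [x^2 - 2]. *)
Lemma log_kernel_fold x t :
  (log_kernel x (fold_branch false t) + log_kernel x (fold_branch true t) <=
   (ln 4)%:E + log_kernel (x ^+ 2 - 2) t)%E.
Proof.
rewrite {3}/log_kernel; case: ifPn => [/andP[/andP[t1 t2] xt]|_]; last by rewrite addey// leey.
set s := Num.sqrt (t + 2).
have s2 : s ^+ 2 = t + 2 by rewrite sqr_sqrtr//; lra.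
have s0 : 0 <= s by exact: sqrtr_ge0.
have sle : s <= 2 by rewrite -ler_sqr ?nnegrE// s2; lra.
have sD (e : bool) : -2 <= (-1) ^+ e * s <= 2.
  by case: e; rewrite ?expr1 ?expr0 ?mulN1r ?mul1r; apply/andP; split; lra.
have xD (e : bool) : x != (-1) ^+ e * s.
  apply: contra xt => /eqP ->; apply/eqP.
  by rewrite exprMn sqrr_sign mul1r s2; ring.
rewrite /log_kernel /fold_branch -/s !sD !xD /= expr0 expr1 mul1r mulN1r.
have x1 := xD false; have x2 := xD true.
rewrite expr0 mul1r in x1; rewrite expr1 mulN1r in x2.
rewrite -!EFinD lee_fin.
have -> : x ^+ 2 - 2 - t = (x - s) * (x - - s) by rewrite (_ : t = s ^+ 2 - 2); [ring|lra].
by rewrite normrM lnM ?posrE ?normr_gt0 ?subr_eq0//; lra.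
Qed.

(** The map [x |-> x^2 - 2] preserves [[-2, 2]], so the hypothesis applies at the image point; half
    of [2 ln 4 + C] is [ln 4 + C / 2]. *)
Lemma log_potential_fold nu C :
  (forall x, -2 <= x <= 2 -> (\int[nu]_y log_kernel x y <= (ln 4 + C)%:E)%E) ->
  forall x, -2 <= x <= 2 ->
    (\int[fold_measure nu]_y log_kernel x y <= (ln 4 + C / 2)%:E)%E.
Proof.
move=> nuC x xD; rewrite integral_fold_measure; last 2 first.
- exact: measurable_log_kernel.
- by move=> y; exact: log_kernel_ge0.
have xD' : -2 <= x ^+ 2 - 2 <= 2.
  move: xD => /andP[x1 x2]; have := sqr_ge0 x => x0.
  by apply/andP; split; [lra|nra].
apply: (@le_trans _ _ (2^-1%:E * \int[nu]_t ((ln 4)%:E + log_kernel (x ^+ 2 - 2) t))%E).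
  by rewrite lee_pmul2l//; apply: le_integral_total => t; exact: log_kernel_fold.
rewrite ge0_integralD//; last 3 first.
- by move=> *; rewrite lee_fin ln_ge0// ler1n.
- by move=> y _; exact: log_kernel_ge0.
- exact: measurable_log_kernel.
have -> : (\int[nu]_y (ln 4)%:E = (ln 4)%:E)%E.
  rewrite (integral_cst _ measurableT) -[RHS]mule1; congr (_ * _)%E.
  exact: probability_setT.
rewrite lee_pdivrMl//.
rewrite -EFinM; apply: (@le_trans _ _ ((ln 4)%:E + (ln 4 + C)%:E)%E).
  by rewrite leeD2l//; exact: nuC.
by rewrite -EFinD lee_fin; lra.
Qed.

Lemma fold_measure_null nu : nu (~` `[-2, 2]%classic) = 0%E ->
  fold_measure nu (~` `[-2, 2]%classic) = 0%E.
Proof.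
move=> nu0; have mI : measurable (`[-2, 2]%classic : set (measurableTypeR R)).
  exact: measurable_itv.
have H s : nu (fold_branch s @^-1` (~` `[-2, 2]%classic)) = 0%E.
  apply/eqP; rewrite -measure_le0 -nu0; apply: le_measure; rewrite ?inE.
  - rewrite -[X in measurable X]setTI; apply: measurable_fold_branch => //.
    exact: measurableC.
  - exact: measurableC.
  move=> t /= h1 h2; apply: h1; move: h2; rewrite /= !in_itv /= => /andP[t1 t2].
  have s2 : Num.sqrt (t + 2) ^+ 2 = t + 2 by rewrite sqr_sqrtr//; lra.
  have s0 : 0 <= Num.sqrt (t + 2) by exact: sqrtr_ge0.
  have sle : Num.sqrt (t + 2) <= 2 by rewrite -ler_sqr ?nnegrE// s2; lra.
  by case: s; rewrite /fold_branch ?expr1 ?expr0 ?mulN1r ?mul1r; apply/andP; split; lra.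
by rewrite fold_measureE !H !mule0 adde0.
Qed.

End capacity_lower_bound.

(** * Capacity of a set containing [[-2, 2]] *)

Section capacity_ge1.
Context {R : realType}.
Implicit Types (x y : R).

Local Notation unif := (uniform_prob (@ltr01 R)).

(* The number of [k] with [2^k <= 4 / |x - y|] is at least [ln (4 / |x - y|)]. *)
Lemma log_kernel_le_series x y : -2 <= x <= 2 -> -2 <= y <= 2 ->
  (log_kernel x y <=
   \sum_(k <oo) (\1_(`[(x - 4 / 2 ^+ k)%R, (x + 4 / 2 ^+ k)%R]%classic) y)%:E)%E.
Proof.
move=> /andP[x1 x2] /andP[y1 y2].
pose F k : \bar R := (\1_(`[(x - 4 / 2 ^+ k)%R, (x + 4 / 2 ^+ k)%R]%classic) y)%:E.
have F0 k : (0 <= F k)%E by rewrite lee_fin.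
have F1 k : `|x - y| <= 4 / 2 ^+ k -> F k = 1%E.
  rewrite ler_norml => /andP[h1 h2]; rewrite /F indicE mem_set//= in_itv /=.
  by apply/andP; split; lra.
have H n : (forall k, (k < n)%N -> `|x - y| <= 4 / 2 ^+ k) -> (n%:R%:E <= \sum_(k <oo) F k)%E.
  move=> h; apply: le_trans (nneseries_lim_ge n _) => //.
  rewrite big_mkord (eq_bigr (fun=> 1%:E)); last by move=> k _; rewrite F1// h.
  by rewrite sumEFin lee_fin sumr_const card_ord.
rewrite -/F /log_kernel y1 y2 /=; have [xy|xy] /= := eqVneq x y.
  have -> : (\sum_(k <oo) F k = +oo)%E; last by [].
  apply/eqyP => A A0.
  apply: le_trans (H (Num.truncn A).+1 _); first by rewrite lee_fin ltW// truncnS_gt.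
  by move=> k _; rewrite xy subrr normr0 divr_ge0 ?exprn_ge0.
have t0 : 0 < `|x - y| by rewrite normr_gt0 subr_eq0.
have t4 : `|x - y| <= 4 by rewrite ler_norml; apply/andP; split; lra.
move: H; set t := `|x - y| in t0 t4 * => H.
have [n n1 n2] : exists2 n, 4 / 2 ^+ n < t & forall k, (k < n)%N -> t <= 4 / 2 ^+ k.
  have ex : exists n, 4 / 2 ^+ n < t.
    exists (Num.truncn (4 / t)).+1; rewrite ltr_pdivrMr ?exprn_gt0// mulrC -ltr_pdivrMr//.
    apply: lt_le_trans (truncnS_gt _) _.
    by rewrite -natrX ler_nat ltnW// ltn_expl.
  exists (ex_minn ex); first by case: ex_minnP.
  case: ex_minnP => m _ min k km; rewrite leNgt; apply/negP => /min.
  by rewrite leqNgt km.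
apply: le_trans (H n n2); rewrite lee_fin.
have h : ln 4 <= ln (t * 2 ^+ n).
  by rewrite ler_ln ?posrE ?mulr_gt0 ?exprn_gt0// ltW// -ltr_pdivrMr ?exprn_gt0.
have l2 : ln 2 <= 1 :> R by have := ln_le_sub1 (2 : R); lra.
rewrite lnM ?posrE ?exprn_gt0// lnXn// -(mulr_natl (ln 2)) in h.
have : n%:R * ln 2 <= n%:R :> R by rewrite -[leRHS]mulr1; apply: ler_wpM2l.
lra.
Qed.

Lemma uniform_log_potential x : -2 <= x <= 2 -> (\int[unif]_y log_kernel x y <= 16%:E)%E.
Proof.
move=> xD; rewrite integral_uniform; last 2 first.
- exact: measurable_log_kernel.
- by move=> y; exact: log_kernel_ge0.
rewrite subr0 invr1 mul1e.
have mI (i : interval R) : measurable ([set` i] : set (measurableTypeR R)).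
  exact: measurable_itv.
pose F k (y : measurableTypeR R) : \bar R :=
  (\1_(`[(x - 4 / 2 ^+ k)%R, (x + 4 / 2 ^+ k)%R]%classic) y)%:E.
have mF k D : measurable_fun D (F k).
  by apply/measurable_EFinP; apply: measurable_indic; exact: mI.
have F0 k y : (0 <= F k y)%E by rewrite lee_fin.
apply: (@le_trans _ _ (\int[lebesgue_measure]_(y in `[0%R, 1%R]) \sum_(k <oo) F k y)%E).
  apply: ge0_le_integral => //.
  - by move=> y _; exact: log_kernel_ge0.
  - by apply: measurable_funTS; exact: measurable_log_kernel.
  - exact: ge0_emeasurable_sum.
  move=> y /=; rewrite in_itv /= => /andP[y0 y1]; apply: log_kernel_le_series => //.
  by apply/andP; split; lra.
rewrite integral_nneseries//.
(* The [k]-th interval has length [8 / 2^k = 16 / 2^(k + 1)], and these lengths sum to 16. *)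
apply: le_trans (epsilon_trick0 xpredT (_ : 0 <= 16 :> R)) => //.
apply: lee_nneseries => [k _ _|k _]; first by apply: integral_ge0 => y _; exact: F0.
rewrite integral_indic//.
apply: (@le_trans _ _ (lebesgue_measure (`[x - 4 / 2 ^+ k, x + 4 / 2 ^+ k]%classic : set R))).
  apply: le_measure; rewrite ?inE; last exact: subIsetl.
  - by apply: measurableI; exact: mI.
  - exact: mI.
rewrite lebesgue_measure_itv /= lte_fin.
case: ifPn => _; rewrite lee_fin; last by rewrite divr_ge0.
by rewrite natrX exprS invfM; lra.
Qed.

Lemma uniform_prob_null : unif (~` `[-2, 2]%classic) = 0%E.
Proof.
rewrite /uniform_prob integral_uniform_pdf (_ : _ `&` _ = set0) ?integral_set0//.
apply/seteqP; split => // y [] /=; rewrite !in_itv /= => h /andP[y0 y1]; apply: h.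
by apply/andP; split; lra.
Qed.

Lemma exists_log_potential_le k : exists nu : probability (measurableTypeR R) R,
  nu (~` `[-2, 2]%classic) = 0%E /\
  forall x, -2 <= x <= 2 -> (\int[nu]_y log_kernel x y <= (ln 4 + 16 / 2 ^+ k)%:E)%E.
Proof.
elim: k => [|k [nu [nu0 nuk]]].
  exists unif; split; first exact: uniform_prob_null.
  move=> x /uniform_log_potential/le_trans; apply.
  by rewrite lee_fin expr0 divr1 lerDr ln_ge0// ler1n.
exists (fold_measure nu); split; first exact: fold_measure_null.
move=> x xD; apply: le_trans (log_potential_fold _ _ nuk x xD) _.
by rewrite lee_fin lerD2l exprSr invfM mulrA.
Qed.

(** The iterated pullbacks are competitors for [K] with energy at most [16 / 2^k], so the infimum of
    the energies is at most 0. *)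
Lemma capacity_ge1 (K : set R) : measurable (K : set (measurableTypeR R)) ->
  `[-2, 2]%classic `<=` K -> (1 <= capacity K)%E.
Proof.
move=> mK DK; rewrite /capacity; set I := ereal_inf _.
have I0 : (I <= 0)%E.
  apply/lee_addgt0Pr => e e0; rewrite add0e.
  have [k hk] : exists k, 16 / 2 ^+ k <= e.
    exists (Num.truncn (16 / e)).+1; rewrite ler_pdivrMr ?exprn_gt0// mulrC -ler_pdivrMr//.
    apply: ltW; apply: lt_le_trans (truncnS_gt _) _.
    by rewrite -natrX ler_nat ltnW// ltn_expl.
  have [nu [nu0 nuk]] := exists_log_potential_le k.
  apply: (@le_trans _ _ (log_energy nu)).
    apply: ereal_inf_lbound; exists nu => //=; apply/eqP; rewrite -measure_le0 -nu0.
    apply: le_measure; rewrite ?inE; first exact: measurableC.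
      by apply: measurableC; exact: measurable_itv.
    exact: subsetC.
  apply: le_trans (log_energy_le _ _ nu0 nuk _) _; last by rewrite lee_fin.
  by rewrite divr_ge0 ?exprn_ge0.
by rewrite -expeR0 ler_expeR -oppe0 leeN2.
Qed.
End capacity_ge1.

(** * The support and the moment functional of the measure *)

Section support.
Context {R : realType} (mu : {finite_measure set (measurableTypeR R) -> \bar R}).

Lemma supp_closed : closed (supp mu).
Proof.
move=> x clx U oU Ux; have [y [Sy Uy]] := clx U (open_nbhs_nbhs (conj oU Ux)).
exact: Sy oU Uy.
Qed.

Lemma measurable_supp : measurable (supp mu : set (measurableTypeR R)).
Proof. exact: closed_measurable supp_closed. Qed.

(* The complement is covered by the countably many null intervals with
   rational endpoints. *)
Lemma suppC_null : mu (~` supp mu) = 0%E.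
Proof.
pose I (pq : rat * rat) : set R := `](ratr pq.1), (ratr pq.2)[%classic.
have mI pq : measurable (I pq : set (measurableTypeR R)) by exact: measurable_itv.
pose F k : set (measurableTypeR R) :=
  if unpickle k is Some pq then if mu (I pq) == 0%E then I pq else set0 else set0.
have F0 k : mu.-negligible (F k).
  rewrite /F; case: (unpickle k) => [pq|]; last exact: negligible_set0.
  by case: ifPn => [/eqP h|_]; [exists (I pq); split | exact: negligible_set0].
have mC : measurable (~` supp mu : set (measurableTypeR R)).
  exact: measurableC measurable_supp.
apply: measure_negligible => //; apply: negligibleS (negligible_bigcup F0).
move=> x /= /existsNP[U /not_implyP[oU /not_implyP[Ux /negP]]].
rewrite -leNgt => U0.
have [r /= r0 rU] : \forall y \near x, U y by exact: open_nbhs_nbhs.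
have [p] : exists q, ratr q \in `](x - r), x[ by apply: rat_in_itvoo; lra.
rewrite in_itv /= => /andP[p1 p2].
have [q] : exists q, ratr q \in `]x, (x + r)[ by apply: rat_in_itvoo; lra.
rewrite in_itv /= => /andP[q1 q2].
exists (pickle (p, q)); first exact: Logic.I.
rewrite /F pickleK.
have IU : I (p, q) `<=` U.
  move=> y; rewrite /I /= in_itv /= => /andP[y1 y2]; apply: rU => /=.
  by rewrite ltr_norml; apply/andP; split; lra.
have -> : mu (I (p, q)) = 0%E.
  apply/eqP; rewrite -measure_le0; apply: le_trans U0.
  by apply: le_measure; rewrite ?inE//; exact: open_measurable.
by rewrite eqxx /I /= in_itv /= p2 q1.
Qed.

Context (Sc : compact (supp mu)).

Lemma supp_bounded : exists2 M : R, 1 <= M & forall x, supp mu x -> `|x| <= M.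
Proof.
have [M [_ HM]] := compact_bounded Sc.
exists (Num.max 1 (M + 1)); first by rewrite le_max lexx.
by move=> x Sx; apply: (HM (Num.max 1 (M + 1)) _ x Sx); rewrite lt_max ltrDl ltr01 orbT.
Qed.

(** Off the support [mu] vanishes, and on that compact set a polynomial is bounded. *)
Lemma integrable_horner (P : {poly R}) : mu.-integrable setT (fun x => (P.[x])%:E).
Proof.
have mP : measurable_fun [set: measurableTypeR R] (fun x => P.[x]).
  by apply: continuous_measurable_fun; exact: continuous_horner.
apply/(negligible_integrable (measurableC measurable_supp) measurableT).
- exact/measurable_EFinP.
- exact: suppC_null.
rewrite setTD setCK; apply: measurable_bounded_integrable.
- exact: measurable_supp.
- by rewrite ltey_eq fin_num_measure//; exact: measurable_supp.
- exact: measurable_funTS.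
have cP : {within supp mu, continuous (fun x => P.[x])}.
  by apply: continuous_subspaceT; exact: continuous_horner.
have [B [_ HB]] := compact_bounded (continuous_compact cP Sc).
by exists B; split; rewrite ?num_real// => c Bc y Sy; apply: (HB c Bc); exists y.
Qed.

Definition moment_functional (P : {poly R}) : R := \int[mu]_x P.[x].

Lemma moment_functional_linear : linear_for *%R moment_functional.
Proof.
move=> c P Q; rewrite /moment_functional.
have -> : (fun x => (c *: P + Q).[x]) = (fun x => c * P.[x] + Q.[x]).
  by apply/funext => x; rewrite hornerD hornerZ.
rewrite RintegralD//; last 2 first.
- have -> : EFin \o (fun x => c * P.[x]) = (fun x => ((c *: P).[x])%:E).
    by apply/funext => x /=; rewrite hornerZ.
  exact: integrable_horner.
- exact: integrable_horner.
by rewrite RintegralZl//; exact: integrable_horner.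
Qed.

Lemma moment_functional_ge0 (P : {poly R}) :
  (forall x, supp mu x -> 0 <= P.[x]) -> 0 <= moment_functional P.
Proof.
move=> P0; rewrite /moment_functional /Rintegral.
rewrite (negligible_integral (measurableC measurable_supp) measurableT).
- by rewrite setTD setCK; apply: Rintegral_ge0.
- exact: integrable_horner.
- exact: suppC_null.
Qed.

(** Support points of modulus at least [2 + d] form a compact set and are isolated, because the
    essential support misses them; a finite subcover by isolating neighbourhoods lists them. *)
Lemma supp_outliers_finite (d M : R) : ess_supp mu = `[-2, 2]%classic ->
  (forall x, supp mu x -> `|x| <= M) -> 0 < d ->
  exists s : seq R, {in s, forall x, `|x| <= M} /\
    forall x, supp mu x -> `|x| <= 2 + d \/ x \in s.
Proof.
move=> ess SM d0; pose T := supp mu `&` [set x | 2 + d <= `|x|].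
have Tc : compact T.
  apply: compact_closedI => //; apply: (@closed_comp R R (fun x => `|x|) [set y | 2 + d <= y]).
    by move=> x _; exact: norm_continuous.
  exact: closed_ge.
have iso x : T x -> exists2 V : set R, open V & V x /\ V `&` supp mu `<=` [set x].
  move=> [Sx /= dx]; have [[_ [V nV VE]]|nx] := pselect (isolated (supp mu) x).
    exists (interior V); first exact: open_interior.
    split => // y [Vy Sy]; rewrite -VE; split => //; exact: interior_subset Vy.
  have : ess_supp mu x by [].
  rewrite ess /= in_itv /= => /andP[x1 x2].
  have : `|x| <= 2 by rewrite ler_norml x1.
  by lra.
pose V x := if pselect (T x) is left h then sval (cid2 (iso x h)) else set0.
have Vo x : T x -> open (V x).
  by move=> Tx; rewrite /V; case: pselect => // h; case: (cid2 _).
have VT x : T x -> V x x /\ V x `&` supp mu `<=` [set x].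
  by move=> Tx; rewrite /V; case: pselect => // h; case: (cid2 _).
move: Tc; rewrite compact_cover => /(_ R T V Vo) [].
  by move=> x Tx; exists x => //; have [] := VT x Tx.
move=> D DT cov; exists [seq x <- finmap.enum_fset D | x \in T]; split.
  by move=> x; rewrite mem_filter => /andP[/set_mem[Sx _] _]; exact: SM.
move=> x Sx; have [xd|xd] := leP `|x| (2 + d); first by left.
right; have Tx : T x by split => //=; exact: ltW.
have [y yD Vyx] := cov x Tx; have /set_mem Ty := DT y yD.
have [_ /(_ x (conj Vyx Sx)) /= xy] := VT y Ty.
by rewrite mem_filter mem_set//= xy.
Qed.

End support.

(** * The orthonormal polynomials have real coefficients *)

Section real_coefficients.
Context {R : realType}.
Local Notation Re := complex.Re.
Local Notation Im := complex.Im.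

Definition re_poly (P : {poly R[i]}) : {poly R} := \poly_(i < size P) Re P`_i.
Definition im_poly (P : {poly R[i]}) : {poly R} := \poly_(i < size P) Im P`_i.

Lemma coef_re_poly P i : (re_poly P)`_i = Re P`_i.
Proof. by rewrite coef_poly; case: ltnP => // h; rewrite nth_default. Qed.

Lemma coef_im_poly P i : (im_poly P)`_i = Im P`_i.
Proof. by rewrite coef_poly; case: ltnP => // h; rewrite nth_default. Qed.

Lemma horner_re_im (P : {poly R[i]}) (x : R) :
  P.[x%:C] = (re_poly P).[x] +i* (im_poly P).[x].
Proof.
rewrite horner_coef !horner_poly; elim: (size P) => [|n IH]; first by rewrite !big_ord0.
rewrite !big_ord_recr /= IH -rmorphXn /=.
by case: (P`_n) => s t; apply/eqP; rewrite eq_complex /= !mulr0 subr0 add0r !eqxx.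
Qed.

Context (mu : {finite_measure set (measurableTypeR R) -> \bar R}).
Context (p : nat -> {poly R[i]}) (p_orth : orthonormal_polys mu p).
Context (Sc : compact (supp mu)).
Local Notation L := (moment_functional mu).
Local Notation q n := (re_poly (p n)).
Local Notation s n := (im_poly (p n)).

Let LD P Q : L (P + Q) = L P + L Q.
Proof. by have := moment_functional_linear mu Sc 1 P Q; rewrite scale1r mul1r. Qed.

Let LZ c P : L (c *: P) = c * L P.
Proof.
have L0 : L 0 = 0 by have := LD 0 0; rewrite addr0; lra.
by have := moment_functional_linear mu Sc c P 0; rewrite !addr0 L0 addr0.
Qed.

Lemma orth_re_im n m :
  L (q n * q m + s n * s m) = (n == m)%:R /\ L (q n * s m - s n * q m) = 0.
Proof.
have [_ _ /(_ n m)] := p_orth; rewrite /cintegral.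
have -> : (fun x => Re ((p n).[x%:C]^*%C * (p m).[x%:C])) =
    (fun x => (q n * q m + s n * s m).[x]).
  by apply/funext => x; rewrite !horner_re_im /= !hornerE; ring.
have -> : (fun x => Im ((p n).[x%:C]^*%C * (p m).[x%:C])) =
    (fun x => (q n * s m - s n * q m).[x]).
  by apply/funext => x; rewrite !horner_re_im /= !hornerE; ring.
rewrite -/(L _) -/(L _) -[(n == m)%:R in RHS](_ : (n == m)%:R%:C = _); last by rewrite rmorph_nat.
by case=> -> ->.
Qed.

Lemma lead_coef_Re n : 0 < Re (lead_coef (p n)) /\ Im (lead_coef (p n)) = 0.
Proof.
have [_ /(_ n) + _] := p_orth; rewrite ltcE /= => /andP[/eqP h ->]; by split.
Qed.

Lemma size_re_poly n : size (q n) = n.+1.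
Proof.
have [/(_ n) sp _ _] := p_orth; have [l0 _] := lead_coef_Re n.
rewrite /re_poly sp size_poly_eq//.
by move: l0; rewrite lead_coefE sp => l0; rewrite gt_eqF.
Qed.

Lemma lead_re_poly n : lead_coef (q n) = Re (lead_coef (p n)).
Proof.
have [/(_ n) sp _ _] := p_orth.
by rewrite !lead_coefE size_re_poly sp coef_re_poly.
Qed.

Lemma size_im_poly n : (size (s n) <= n)%N.
Proof.
have [/(_ n) sp _ _] := p_orth; have [_ l0] := lead_coef_Re n.
apply/leq_sizeP => j; rewrite coef_im_poly leq_eqVlt => /predU1P[<-|nj].
  by move: l0; rewrite lead_coefE sp.
by rewrite nth_default ?sp.
Qed.

(** The leading coefficient is real, so [s n] has degree below [n] and lies in the span of the
    earlier [q k]. For these [s k = 0] by induction, and the imaginary part of the orthogonality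
    relation makes [s n] orthogonal to each [q k]. *)
Lemma im_poly_eq0 n : s n = 0.
Proof.
elim/ltn_ind: n => n IH.
have [c cE] := size_span _ size_re_poly
  (fun k => eq_ind_r (fun y => 0 < y) (proj1 (lead_coef_Re k)) (lead_re_poly k))
  n _ (size_im_poly n).
have orth k j : (k < n)%N -> (j < n)%N -> L (q k * q j) = (k == j)%:R.
  move=> kn jn; have [<- _] := orth_re_im k j.
  by rewrite (IH k kn) mul0r addr0.
have Lsum k (f : nat -> {poly R}) : L (\sum_(i < k) f i) = \sum_(i < k) L (f i).
  elim: k => [|k IHk]; last by rewrite !big_ord_recr LD IHk.
  by rewrite !big_ord0; have := LZ 0 0; rewrite scale0r mul0r.
have c0 k : (k < n)%N -> c k = 0.
  move=> kn; have [_] := orth_re_im k n; rewrite (IH k kn) mul0r subr0 cE mulr_sumr.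
  rewrite (Lsum n (fun i => q k * (c i *: q i))) (bigD1 (Ordinal kn))//= big1.
    by rewrite -scalerAr LZ orth// eqxx mulr1 addr0.
  move=> i ik; rewrite -scalerAr LZ orth//; case: eqP => [e|]; last by rewrite mulr0.
  by case/eqP: ik; apply: val_inj.
by rewrite cE big1// => i _; rewrite c0// scale0r.
Qed.

Lemma orth_re_poly n m : L (q n * q m) = (n == m)%:R.
Proof. by have [] := orth_re_im n m; rewrite !im_poly_eq0 mul0r addr0. Qed.

Lemma map_re_poly n : p n = map_poly (real_complex R) (q n).
Proof.
apply/polyP => i; rewrite coef_map /= coef_re_poly.
have := coef_im_poly (p n) i; rewrite im_poly_eq0 coef0.
by case: ((p n)`_i) => x y /= <-.
Qed.

(** The limit of [kappa_n^(-1/n)] is at least 1, hence exceeds [expR (- e)]; taking logarithms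
    bounds [ln kappa_n] above. *)
Lemma regular_lead_le : `[-2, 2]%classic `<=` supp mu -> regular mu ->
  forall e : R, 0 < e -> exists n0, forall n, (n0 <= n)%N ->
    ln (lead_coef (q n)) <= e * n%:R.
Proof.
move=> DS /(_ p p_orth) reg e e0.
have cap := capacity_ge1 _ (measurable_supp mu) DS.
have cap' : ((expR (- e))%:E < capacity (supp mu))%E.
  by apply: lt_le_trans cap; rewrite lte_fin expR_lt1 oppr_lt0.
have oS : open [set y : \bar R | ((expR (- e))%:E < y)%E] by exact: open_ereal_gt_ereal.
have [n0 _ H] := reg _ (open_nbhs_nbhs (conj oS cap')).
exists n0.+1 => n n0n; have := H n (ltnW n0n); rewrite /= lte_fin lead_re_poly.
have [l0 _] := lead_coef_Re n; move: (Re _) l0 => l l0.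
have n1 : 0 < n%:R :> R by rewrite ltr0n; apply: leq_trans n0n.
rewrite /powR gt_eqF// ltr_expR mulNr ltrN2 mulrC ltr_pdivrMr//.
exact: ltW.
Qed.

End real_coefficients.

(** * Evaluation at a point off the support *)

Section evaluation.
Context {R : realType}.
Local Notation Re := complex.Re.
Local Notation Im := complex.Im.
Local Notation nc := Normc.normc.

Lemma supp_dist_gt0 (mu : {finite_measure set (measurableTypeR R) -> \bar R}) (z : R[i]) :
  ~ (exists2 x : R, supp mu x & z = x%:C) ->
  exists2 d : R, 0 < d & forall x, supp mu x -> d <= (x - Re z) ^+ 2 + Im z ^+ 2.
Proof.
move=> zS; have [z0|z0] := eqVneq (Im z) 0; last first.
  by exists (Im z ^+ 2) => [|x _]; rewrite ?lerDr ?sqr_ge0// lt0r sqr_ge0 sqrf_eq0 z0.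
have nS : ~ supp mu (Re z).
  by move=> Sz; apply: zS; exists (Re z) => //; case: (z) z0 => x y /= ->.
have [r /= r0 rS] : \forall y \near Re z, ~ supp mu y.
  exact: (open_nbhs_nbhs (conj (closed_openC (supp_closed mu)) nS)).
exists (r ^+ 2) => [|x Sx]; first by rewrite exprn_gt0.
rewrite z0 expr0n addr0 -[leRHS]real_normK ?num_real// ler_sqr ?nnegrE// ?(ltW r0)//.
by rewrite leNgt distrC; apply/negP => /rS.
Qed.

Context (L : {scalar {poly R}}) (q : nat -> {poly R}).
Context (size_q : forall n, size (q n) = n.+1).
Context (lead_q : forall n, 0 < lead_coef (q n)).
Context (orth_q : forall n m, L (q n * q m) = (n == m)%:R).
Context (S : set R) (M : R).
Context (L_ge0 : forall P : {poly R}, (forall x, S x -> 0 <= P.[x]) -> 0 <= L P).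
Context (SM : forall x, S x -> `|x| <= M) (M1 : 1 <= M).
Context (z : R[i]).

Local Notation a := (jac_a L q).
Local Notation b := (jac_b L q).
Local Notation c k := (map_poly (real_complex R) (q k)).[z].

Lemma complex_jacobi_rec0 : z * c 0 = (a 0)%:C * c 1 + (b 0)%:C * c 0.
Proof.
have := congr1 (fun P => (map_poly (real_complex R) P).[z])
  (jacobi_rec0 _ _ size_q lead_q orth_q).
by rewrite /= rmorphM rmorphD /= map_polyX !map_polyZ !hornerE.
Qed.

Lemma complex_jacobi_recS k :
  z * c k.+1 = (a k.+1)%:C * c k.+2 + (b k.+1)%:C * c k.+1 + (a k)%:C * c k.
Proof.
have := congr1 (fun P => (map_poly (real_complex R) P).[z])
  (jacobi_recS _ _ size_q lead_q orth_q k).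
by rewrite /= rmorphM !rmorphD /= map_polyX !map_polyZ !hornerE.
Qed.

(** The kernel bound for the real and imaginary parts of [c], with [a n <= M], yields [M / sqrt d]
    for [k <= n]; the summand 1 covers [k = n + 1]. The constant does not depend on [n]. *)
Lemma complex_eval_bound (d : R) : 0 < d ->
  (forall x, S x -> d <= (x - Re z) ^+ 2 + Im z ^+ 2) ->
  forall n k, (k <= n.+1)%N ->
    nc (c k) <= (1 + M / Num.sqrt d) * (nc (c n) + nc (c n.+1)).
Proof.
move=> d0 dS n k; have M1' := M1; have M0 : 0 <= M by lra.
have s0 : 0 < Num.sqrt d by rewrite sqrtr_gt0.
have C0 : 0 <= M / Num.sqrt d by rewrite divr_ge0// ltW.
have x0 := normc_ge0 (c n); have y0 := normc_ge0 (c n.+1).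
rewrite leq_eqVlt => /predU1P[->|]; first by nra.
move=> kn; suff : nc (c k) <= M / Num.sqrt d * (nc (c n) + nc (c n.+1)) by lra.
have recRe j : Re z * Re (c j) - Im z * Im (c j) = jac_op L q (fun k => Re (c k)) j.
  case: j => [|j]; rewrite /jac_op.
    have := congr1 (@complex.Re R) complex_jacobi_rec0.
    by case: (z) (c 0) (c 1) => s t [u v] [u' v'] /=; lra.
  have := congr1 (@complex.Re R) (complex_jacobi_recS j).
  by case: (z) (c j) (c j.+1) (c j.+2) => s t [u v] [u' v'] [u'' v''] /=; lra.
have recIm j : Re z * Im (c j) + Im z * Re (c j) = jac_op L q (fun k => Im (c k)) j.
  case: j => [|j]; rewrite /jac_op.
    have := congr1 (@complex.Im R) complex_jacobi_rec0.
    by case: (z) (c 0) (c 1) => s t [u v] [u' v'] /=; lra.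
  have := congr1 (@complex.Im R) (complex_jacobi_recS j).
  by case: (z) (c j) (c j.+1) (c j.+2) => s t [u v] [u' v'] [u'' v''] /=; lra.
have := kernel_bound _ _ size_q lead_q orth_q S L_ge0 _ _ _ _ _ n dS recRe recIm.
have -> : Re (c n) ^+ 2 + Re (c n.+1) ^+ 2 + (Im (c n) ^+ 2 + Im (c n.+1) ^+ 2) =
    nc (c n) ^+ 2 + nc (c n.+1) ^+ 2 by rewrite !normc_sqr; ring.
have ck : nc (c k) ^+ 2 <= \sum_(j < n.+1) (Re (c j) ^+ 2 + Im (c j) ^+ 2).
  rewrite (bigD1 (Ordinal kn))//= normc_sqr lerDl sumr_ge0// => j _.
  by rewrite addr_ge0 ?sqr_ge0.
have aM : a n ^+ 2 <= M ^+ 2.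
  rewrite ler_sqr ?nnegrE ?(ltW (jac_a_gt0 _ _ size_q lead_q orth_q n))//.
  exact: (jac_a_le _ _ orth_q S).
move=> H; rewrite -ler_sqr ?nnegrE ?normc_ge0//; last by rewrite mulr_ge0// addr_ge0.
rewrite exprMn expr_div_n sqr_sqrtr ?(ltW d0)// mulrAC ler_pdivlMr// mulrC.
apply: le_trans (ler_wpM2l (ltW d0) ck) _; apply: le_trans H _.
apply: ler_pM => //; rewrite ?sqr_ge0//; first by rewrite addr_ge0 ?sqr_ge0.
by rewrite sqrrD; have : 0 <= nc (c n) * nc (c n.+1) by [exact: mulr_ge0]; lra.
Qed.

Lemma complex_eval0_neq0 : c 0 != 0.
Proof.
have /size1_polyC E : (size (q 0%N) <= 1)%N by rewrite size_q.
have := lead_q 0; rewrite E lead_coefC map_polyC hornerC /= => q0.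
by rewrite fmorph_eq0 gt_eqF.
Qed.

End evaluation.

(** * Ratio asymptotics along a set of density one *)

Theorem theorem3p2 (R : realType)
    (mu : {finite_measure set (measurableTypeR R) -> \bar R})
    (p : nat -> {poly R[i]}) :
  compact (supp mu) -> infinite_set (supp mu) ->
  orthonormal_polys mu p ->
  regular mu ->
  ess_supp mu = `[-2, 2]%classic ->
  exists N : set nat,
    density_one R N /\
    forall z : R[i], ~ (exists2 x : R, supp mu x & z = x%:C) ->
      phi z * (p n.-1).[z] / (p n).[z] @[n --> within N \oo] --> (1 : R[i]^o).
Proof.
move=> Sc _ p_orth reg ess.
have DS : `[-2, 2]%classic `<=` supp mu by rewrite -ess => x [].
have [M M1 SM] := supp_bounded mu Sc.
pose Lm := GRing.isLinear.Build R {poly R} R *%R (moment_functional mu)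
  (moment_functional_linear mu Sc).
pose L : {scalar {poly R}} := HB.pack (moment_functional mu) Lm.
pose q n := re_poly (p n).
have size_q n : size (q n) = n.+1 by exact: size_re_poly p_orth n.
have lead_q n : 0 < lead_coef (q n).
  by rewrite (lead_re_poly _ _ p_orth); have [] := lead_coef_Re _ _ p_orth n.
have orth_q n m : L (q n * q m) = (n == m)%:R by exact: orth_re_poly p_orth Sc n m.
have L_ge0 := moment_functional_ge0 mu Sc.
have outliers d := supp_outliers_finite mu Sc d M ess SM.
have lead_small := regular_lead_le mu p p_orth DS reg.
have cesaro := jac_cesaro_null L q size_q lead_q orth_q (supp mu) M L_ge0 SM M1
  outliers lead_small.
(* The set [N] depends only on the Jacobi coefficients and is fixed before [z], so it serves all [z]
   at once. *)
have [|N [N1 HN]] := cesaro_null_density _ _ cesaro.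
  by move=> k; apply: addr_ge0; [exact: sqr_ge0 | apply: mulr_ge0 => //; exact: sqr_ge0].
exists N; split => // z zS.
have zN (x : R) : z = x%:C -> ~ (-2 <= x <= 2).
  by move=> zx xD; apply: zS; exists x => //; apply: DS; rewrite /= in_itv.
have [w_gt1 zw] := phi_joukowski z zN.
have [d d0 dS] := supp_dist_gt0 mu z zS.
have recS k := complex_jacobi_recS L q size_q lead_q orth_q z k.
have cle := complex_eval_bound L q size_q lead_q orth_q (supp mu) M L_ge0 SM M1 z d d0 dS.
have C0 : 0 < 1 + M / Num.sqrt d.
  by rewrite ltr_wpDr// divr_ge0 ?sqrtr_ge0// (le_trans ler01).
have c0 := complex_eval0_neq0 q size_q lead_q z.
have H := ratio_cvg _ _ _ _ _ recS w_gt1 zw _ C0 c0 cle N HN.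
have FF : Filter (within N \oo) by exact: within_filter.
apply/(@cvgrPdist_le R[i] R[i]^o _ _ FF) => e e0.
have [e1 eE] : 0 < complex.Re e /\ e = (complex.Re e)%:C.
  by move: e0; case: (e) => x y; rewrite ltcE /= => /andP[/eqP -> x0]; split; [exact: x0|].
have [n0 Hn0] := H _ e1.
exists n0; first exact: Logic.I.
move=> n n0n Nn /=.
have Ep k : (p k).[z] = (map_poly (real_complex R) (q k)).[z].
  by rewrite -(map_re_poly _ _ p_orth Sc).
by rewrite distrC eE !Ep lecR; exact: Hn0.
Qed.
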